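(* The 2-category $\mathrm{qCat}_2$ is cartesian closed as a 2-category. That is, the terminal simplicial set $\Delta^0$, the products $B\times C$ and the internal homs $C^B$ of quasi-categories (formed in simplicial sets) are quasi-categories, and there are canonical isomorphisms of categories, natural in all variables, $$\hom'(A,\Delta^0)\cong\mathbf 1,\qquad \hom'(A,B\times C)\cong\hom'(A,B)\times\hom'(A,C),\qquad \hom'(A,C^B)\cong\hom'(A\times B,C),$$ for all quasi-categories $A,B,C$.
   Context: A quasi-category is a simplicial set with fillers for all inner horns $\Lambda^{n,k}\to\Delta^n$ ($n\ge2$, $0<k<n$); functors are simplicial maps between quasi-categories. $\mathrm{qCat}_2$ is the strict 2-category whose objects are quasi-categories and whose hom-categories are $\hom'(A,B)=h(B^A)$, where $B^A$ is the internal hom of simplicial sets and $h\colon\mathrm{sSet}\to\mathrm{Cat}$ is the (finite-product-preserving) left adjoint of the nerve functor; composition is induced by that of the simplicially enriched category of quasi-categories. $\mathbf 1$ is the terminal category. *)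

(* Defs.v *)
From mathcomp Require Import all_boot.
From Stdlib Require Import FunctionalExtensionality PropExtensionality.
From Stdlib Require Import ProofIrrelevance ClassicalEpsilon.

Set Implicit Arguments.
Unset Strict Implicit.
Unset Printing Implicit Defensive.

(* Equality of objects, morphisms and functors is Leibniz equality throughout,
   so that isomorphisms of categories and 2-categorical laws are strict. *)

Record Category := MkCategory {
  Ob :> Type;
  Hom : Ob -> Ob -> Type;
  cid : forall x, Hom x x;
  ccomp : forall x y z, Hom y z -> Hom x y -> Hom x z;
  ccompA : forall x y z t (h : Hom z t) (g : Hom y z) (f : Hom x y),
    ccomp h (ccomp g f) = ccomp (ccomp h g) f;
  ccomp1l : forall x y (f : Hom x y), ccomp (cid y) f = f;
  ccomp1r : forall x y (f : Hom x y), ccomp f (cid x) = f }.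

Arguments Hom {c} x y.
Arguments cid {c} x.
Arguments ccomp {c x y z} g f.

Record Functor (C D : Category) := MkFunctor {
  fob :> C -> D;
  fmap : forall x y : C, Hom x y -> Hom (fob x) (fob y);
  fmap1 : forall x, fmap (cid x) = cid (fob x);
  fmapM : forall x y z (g : Hom y z) (f : Hom x y),
    fmap (ccomp g f) = ccomp (fmap g) (fmap f) }.

Arguments fmap {C D} f {x y} u : rename.

(* A morphism together with its endpoints; used to compare morphisms whose
   endpoints are only propositionally equal. *)
Definition arr (C : Category) (x y : C) (f : Hom x y) :
  {x : C & {y : C & Hom x y}} := existT _ x (existT _ y f).

Lemma arr_inj (C : Category) (x y : C) (f g : Hom x y) : arr f = arr g -> f = g.
Proof. by move=> e; exact: (inj_pair2 _ _ _ _ _ (inj_pair2 _ _ _ _ _ e)). Qed.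

Lemma arr_src (C : Category) (x y x' y' : C) (f : Hom x y) (g : Hom x' y') :
  arr f = arr g -> x = x'.
Proof. by case. Qed.

Lemma arr_tgt (C : Category) (x y x' y' : C) (f : Hom x y) (g : Hom x' y') :
  arr f = arr g -> y = y'.
Proof. by case. Qed.

Lemma arr_comp (C : Category) (x y z x' y' z' : C)
    (g : Hom y z) (f : Hom x y) (g' : Hom y' z') (f' : Hom x' y') :
  arr g = arr g' -> arr f = arr f' -> arr (ccomp g f) = arr (ccomp g' f').
Proof.
move=> eg ef; have ex := arr_src ef; have ey := arr_src eg.
have ez := arr_tgt eg; subst.
by rewrite (arr_inj eg) (arr_inj ef).
Qed.

Lemma arr_fmap (C D : Category) (F : Functor C D) (x y x' y' : C)
    (f : Hom x y) (g : Hom x' y') :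
  arr f = arr g -> arr (fmap F f) = arr (fmap F g).
Proof.
move=> e; have ex := arr_src e; have ey := arr_tgt e; subst.
by rewrite (arr_inj e).
Qed.

Definition hcast (C : Category) (x y x' y' : C) (ex : x = x') (ey : y = y')
  (f : Hom x y) : Hom x' y' := ecast z (Hom x' z) ey (ecast z (Hom z y) ex f).

Lemma arr_hcast (C : Category) (x y x' y' : C) (ex : x = x') (ey : y = y')
  (f : Hom x y) : arr (hcast ex ey f) = arr f.
Proof. by case: y' / ey; case: x' / ex. Qed.

Lemma functor_ext (C D : Category) (F G : Functor C D) :
  (forall (x y : C) (f : Hom x y), arr (fmap F f) = arr (fmap G f)) -> F = G.
Proof.
move=> e; have eob : fob F = fob G.
  by apply: functional_extensionality => x; exact: arr_src (e x x (cid x)).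
case: F G eob e => [F Fm F1 FM] [G Gm G1 GM] /= eob; subst G => e.
have em : Fm = Gm.
  apply: functional_extensionality_dep => x.
  apply: functional_extensionality_dep => y.
  by apply: functional_extensionality => f; exact: (arr_inj (e x y f)).
by subst Gm; congr MkFunctor; exact: proof_irrelevance.
Qed.

Definition fid (C : Category) : Functor C C :=
  @MkFunctor C C (fun x => x) (fun _ _ f => f) (fun=> erefl)
    (fun _ _ _ _ _ => erefl).
Arguments fid {C}.

Program Definition fcomp (C D E : Category) (G : Functor D E) (F : Functor C D) :
    Functor C E :=
  @MkFunctor C E (fun x => G (F x)) (fun _ _ f => fmap G (fmap F f)) _ _.
Next Obligation. by rewrite !fmap1. Qed.
Next Obligation. by rewrite !fmapM. Qed.
Notation "G \oc F" := (fcomp G F) (at level 50, left associativity).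

Lemma fmap_fcomp (C D E : Category) (G : Functor D E) (F : Functor C D)
    (x y : C) (f : Hom x y) : fmap (G \oc F) f = fmap G (fmap F f).
Proof. by []. Qed.

Definition is_iso_functor (C D : Category) (F : Functor C D) : Prop :=
  exists G : Functor D C, G \oc F = fid /\ F \oc G = fid.

Definition cat1 : Category :=
  @MkCategory unit (fun _ _ => unit) (fun=> tt) (fun _ _ _ _ _ => tt)
    (fun _ _ _ _ _ _ _ => erefl)
    (fun _ _ f => match f with tt => erefl end)
    (fun _ _ f => match f with tt => erefl end).

Definition to_cat1 (C : Category) : Functor C cat1 :=
  @MkFunctor C cat1 (fun=> tt) (fun _ _ _ => tt) (fun=> erefl)
    (fun _ _ _ _ _ => erefl).

Program Definition fconst (C D : Category) (d : D) : Functor C D :=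
  @MkFunctor C D (fun=> d) (fun _ _ _ => cid d) (fun=> erefl) _.
Next Obligation. by rewrite ccomp1l. Qed.

Program Definition cprod (C D : Category) : Category :=
  @MkCategory (C * D) (fun p q => Hom p.1 q.1 * Hom p.2 q.2)%type
    (fun p => (cid p.1, cid p.2))
    (fun _ _ _ g f => (ccomp g.1 f.1, ccomp g.2 f.2)) _ _ _.
Next Obligation. by rewrite !ccompA. Qed.
Next Obligation. by rewrite !ccomp1l. Qed.
Next Obligation. by rewrite !ccomp1r. Qed.
Notation "C *c D" := (cprod C D) (at level 40, left associativity).

Definition ffst (C D : Category) : Functor (C *c D) C :=
  @MkFunctor (C *c D) C fst (fun _ _ f => f.1) (fun=> erefl)
    (fun _ _ _ _ _ => erefl).
Arguments ffst {C D}.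

Definition fsnd (C D : Category) : Functor (C *c D) D :=
  @MkFunctor (C *c D) D snd (fun _ _ f => f.2) (fun=> erefl)
    (fun _ _ _ _ _ => erefl).
Arguments fsnd {C D}.

Program Definition fpair (E C D : Category) (F : Functor E C) (G : Functor E D) :
    Functor E (C *c D) :=
  @MkFunctor E (C *c D) (fun x => (F x, G x)) (fun _ _ f => (fmap F f, fmap G f))
    _ _.
Next Obligation. by rewrite !fmap1. Qed.
Next Obligation. by rewrite !fmapM. Qed.
Notation "<| F , G |>" := (fpair F G) (at level 0, F, G at level 99).

Definition fcross (C C' D D' : Category) (F : Functor C C') (G : Functor D D') :
  Functor (C *c D) (C' *c D') := <| F \oc ffst, G \oc fsnd |>.

Lemma fcompA (C D E E' : Category)
    (H : Functor E E') (G : Functor D E) (F : Functor C D) :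
  H \oc (G \oc F) = H \oc G \oc F.
Proof. exact: functor_ext. Qed.

Lemma fcomp1l (C D : Category) (F : Functor C D) : fid \oc F = F.
Proof. exact: functor_ext. Qed.

Lemma fcomp1r (C D : Category) (F : Functor C D) : F \oc fid = F.
Proof. exact: functor_ext. Qed.

Lemma fst_fpair (E C D : Category) (F : Functor E C) (G : Functor E D) :
  ffst \oc <| F, G |> = F.
Proof. exact: functor_ext. Qed.

Lemma snd_fpair (E C D : Category) (F : Functor E C) (G : Functor E D) :
  fsnd \oc <| F, G |> = G.
Proof. exact: functor_ext. Qed.

Lemma fpair_ext (E C D : Category) (F G : Functor E (C *c D)) :
  ffst \oc F = ffst \oc G -> fsnd \oc F = fsnd \oc G -> F = G.
Proof.
have eta (H : Functor E (C *c D)) : H = <| ffst \oc H, fsnd \oc H |>.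
  apply: functor_ext => x y f /=.
  have e2 (a b : C *c D) (g : Hom a b) :
      arr g = @arr (C *c D) (a.1, a.2) (b.1, b.2) (g.1, g.2).
    by case: a b g => [a1 a2] [b1 b2] [g1 g2].
  exact: e2.
by move=> e1 e2; rewrite (eta F) (eta G) e1 e2.
Qed.

Lemma fpair_comp (E' E C D : Category) (F : Functor E C) (G : Functor E D)
    (H : Functor E' E) : <| F, G |> \oc H = <| F \oc H, G \oc H |>.
Proof. exact: functor_ext. Qed.

(* [Dhom m n] is the set of morphisms [m] -> [n] of the simplex category.
   Primitive projections make its category laws hold by conversion. *)
#[projections(primitive)] Record Dhom (m n : nat) := MkDhom {
  Dfun :> 'I_m.+1 -> 'I_n.+1;
  Dmono : forall i j : 'I_m.+1, i <= j -> Dfun i <= Dfun j }.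

Lemma Dhom_ext m n (f g : Dhom m n) : (forall i, f i = g i :> nat) -> f = g.
Proof.
move=> e; have ef : Dfun f = Dfun g.
  by apply: functional_extensionality => i; apply: val_inj; exact: e.
case: f g ef {e} => [f Hf] [g Hg] /= e; subst g.
by congr MkDhom; exact: proof_irrelevance.
Qed.

Definition Did n : Dhom n n := @MkDhom n n (fun i => i) (fun _ _ H => H).

Definition Dcomp m n p (g : Dhom n p) (f : Dhom m n) : Dhom m p :=
  @MkDhom m p (fun i => g (f i)) (fun _ _ H => Dmono g (Dmono f H)).

(* The coface omitting [i]. *)
Program Definition Dface n (i : 'I_n.+2) : Dhom n n.+1 :=
  @MkDhom n n.+1 (lift i) _.
Next Obligation. by rewrite leq_bump2. Qed.

Lemma unbump_lt n (i : 'I_n.+1) (j : 'I_n.+2) : unbump i j < n.+1.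
Proof.
rewrite /unbump; case: (ltnP i j) => /= ij.
  by case: j ij => [[|j] //= Hj] _; rewrite subn1.
by rewrite subn0 (leq_ltn_trans ij).
Qed.

Lemma unbump_mono n (i : 'I_n.+1) (j k : 'I_n.+2) :
  j <= k -> unbump i j <= unbump i k.
Proof.
move=> jk; rewrite /unbump.
case: (ltnP i j) => ij; case: (ltnP i k) => ik //=; rewrite ?subn0 ?leq_sub2r //.
- by have := leq_trans ij jk; rewrite ltnNge ik.
- by rewrite subn1 -ltnS (ltn_predK ik) (leq_ltn_trans ij ik).
Qed.

(* The codegeneracy hitting [i] twice. *)
Definition Ddegen n (i : 'I_n.+1) : Dhom n.+1 n :=
  @MkDhom n.+1 n (fun j => Ordinal (unbump_lt i j)) (unbump_mono i).

Record sSet := MkSSet {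
  simp :> nat -> Type;
  sact : forall m n, Dhom m n -> simp n -> simp m;
  sact1 : forall n (x : simp n), sact (Did n) x = x;
  sactM : forall m n p (g : Dhom n p) (f : Dhom m n) (x : simp p),
    sact (Dcomp g f) x = sact f (sact g x) }.

Arguments sact {s m n} f x.

Record sMap (X Y : sSet) := MkSMap {
  smap :> forall n, X n -> Y n;
  smapN : forall m n (f : Dhom m n) (x : X n),
    smap (sact f x) = sact f (smap x) }.

Arguments smap {X Y} s {n} x.
Arguments smapN {X Y} s {m n} f x.

Lemma sMap_ext (X Y : sSet) (f g : sMap X Y) :
  (forall n (x : X n), f n x = g n x) -> f = g.
Proof.
move=> e; have ef : @smap X Y f = @smap X Y g.
  apply: functional_extensionality_dep => n.
  by apply: functional_extensionality => x; exact: e.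
case: f g ef {e} => [f Hf] [g Hg] /= e; subst g.
by congr MkSMap; exact: proof_irrelevance.
Qed.

Definition sid (X : sSet) : sMap X X :=
  @MkSMap X X (fun _ x => x) (fun _ _ _ _ => erefl).

Program Definition scomp (X Y Z : sSet) (g : sMap Y Z) (f : sMap X Y) : sMap X Z :=
  @MkSMap X Z (fun n x => g n (f n x)) _.
Next Obligation. by rewrite !smapN. Qed.
Notation "g \os f" := (scomp g f) (at level 50, left associativity).

Definition face (X : sSet) n (i : 'I_n.+2) (x : X n.+1) : X n := sact (Dface i) x.
Definition degen (X : sSet) n (i : 'I_n.+1) (x : X n) : X n.+1 := sact (Ddegen i) x.

Definition Delta (n : nat) : sSet :=
  @MkSSet (fun m => Dhom m n) (fun _ _ f x => Dcomp x f)
    (fun _ _ => erefl) (fun _ _ _ _ _ _ => erefl).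

Program Definition sprod (X Y : sSet) : sSet :=
  @MkSSet (fun n => X n * Y n)%type (fun _ _ f x => (sact f x.1, sact f x.2)) _ _.
Next Obligation. by rewrite !sact1. Qed.
Next Obligation. by rewrite !sactM. Qed.
Notation "X *s Y" := (sprod X Y) (at level 40, left associativity).

Definition sfst (X Y : sSet) : sMap (X *s Y) X :=
  @MkSMap (X *s Y) X (fun _ x => x.1) (fun _ _ _ _ => erefl).
Definition ssnd (X Y : sSet) : sMap (X *s Y) Y :=
  @MkSMap (X *s Y) Y (fun _ x => x.2) (fun _ _ _ _ => erefl).

Program Definition spair (Z X Y : sSet) (f : sMap Z X) (g : sMap Z Y) :
    sMap Z (X *s Y) :=
  @MkSMap Z (X *s Y) (fun n z => (f n z, g n z)) _.
Next Obligation. by rewrite !smapN. Qed.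

(* The internal hom C^B, whose n-simplices are the maps B * Delta n -> C. *)
Program Definition sexp_act (B C : sSet) m n (f : Dhom m n)
    (u : sMap (B *s Delta n) C) : sMap (B *s Delta m) C :=
  @MkSMap (B *s Delta m) C (fun k (p : (B *s Delta m) k) =>
    u k (p.1, Dcomp f p.2)) _.
Next Obligation. by rewrite -smapN. Qed.

Program Definition sexp (B C : sSet) : sSet :=
  @MkSSet (fun n => sMap (B *s Delta n) C) (@sexp_act B C) _ _.
Next Obligation. by apply: sMap_ext => m [b s]. Qed.
Next Obligation. by apply: sMap_ext => k [b s]. Qed.

(* The horn: the maps [m] -> [n] whose image omits some vertex other than [k]. *)
Definition in_horn n (k : 'I_n.+1) m (f : Dhom m n) : Prop :=
  exists2 i : 'I_n.+1, i <> k & forall j, f j <> i.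

Lemma in_horn_comp n (k : 'I_n.+1) m p (f : Dhom m n) (g : Dhom p m) :
  in_horn k f -> in_horn k (Dcomp f g).
Proof. by case=> i ik Hi; exists i => // j; exact: Hi. Qed.

Program Definition horn n (k : 'I_n.+1) : sSet :=
  @MkSSet (fun m => {f : Dhom m n | in_horn k f})
    (fun _ _ g f => exist _ (Dcomp (sval f) g) (in_horn_comp g (svalP f))) _ _.
Next Obligation. by congr exist; exact: proof_irrelevance. Qed.
Next Obligation. by congr exist; exact: proof_irrelevance. Qed.

Definition horn_incl n (k : 'I_n.+1) : sMap (horn k) (Delta n) :=
  @MkSMap (horn k) (Delta n) (fun _ f => sval f) (fun _ _ _ _ => erefl).

Definition is_qcat (X : sSet) : Prop :=
  forall (n : nat) (k : 'I_n.+1), 2 <= n -> 0 < k -> k < n ->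
  forall f : sMap (horn k) X, exists g : sMap (Delta n) X, g \os horn_incl k = f.

Record QCat := MkQCat { qcat_sset :> sSet; qcatP : is_qcat qcat_sset }.

Definition quot (A : Type) (R : A -> A -> Prop) : Type :=
  {P : A -> Prop | exists a, P = R a}.

Definition qcl (A : Type) (R : A -> A -> Prop) (a : A) : quot R :=
  exist _ (R a) (ex_intro _ a erefl).

Definition qrepr (A : Type) (R : A -> A -> Prop) (q : quot R) : A :=
  sval (constructive_indefinite_description _ (svalP q)).

Lemma qcl_repr (A : Type) (R : A -> A -> Prop) (q : quot R) : qcl R (qrepr q) = q.
Proof.
rewrite /qcl /qrepr; case: constructive_indefinite_description => a /= ea.
case: q ea => P HP /= ea; subst P; congr exist; exact: proof_irrelevance.
Qed.

Lemma qcl_inv (A : Type) (R : A -> A -> Prop) (a b : A) :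
  (forall a, R a a) -> qcl R a = qcl R b -> R a b.
Proof. by move=> Rr [e]; rewrite e. Qed.

(* The left adjoint h of the nerve (see [h_left_adjoint_nerve] below): the
   category h X has the vertices of [X] as objects and is generated by the
   edges of [X], subject to: degenerate edges are identities, and
   d_1 s = d_0 s o d_2 s for every 2-simplex [s]. *)

(* [d_ n i : X n.+1 -> X n] and [s_ n i : X n -> X n.+1]; an edge [e] goes from
   [d_ 0 1 e] to [d_ 0 0 e]. *)
Notation d_ n i := (@face _ n (@Ordinal n.+2 i isT)) (only parsing).
Notation s_ n i := (@degen _ n (@Ordinal n.+1 i isT)) (only parsing).

Inductive hterm (X : sSet) : X 0 -> X 0 -> Type :=
| TId x : hterm x x
| TEdge x y (e : X 1) : d_ 0 1 e = x -> d_ 0 0 e = y -> hterm x y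
| TComp x y z : hterm y z -> hterm x y -> hterm x z.

Inductive hrel (X : sSet) : forall x y : X 0, hterm x y -> hterm x y -> Prop :=
| hrel_refl x y (t : hterm x y) : hrel t t
| hrel_sym x y (t u : hterm x y) : hrel t u -> hrel u t
| hrel_trans x y (t u v : hterm x y) : hrel t u -> hrel u v -> hrel t v
| hrel_comp x y z (t t' : hterm y z) (u u' : hterm x y) :
    hrel t t' -> hrel u u' -> hrel (TComp t u) (TComp t' u')
| hrel_assoc x y z w (t : hterm z w) (u : hterm y z) (v : hterm x y) :
    hrel (TComp t (TComp u v)) (TComp (TComp t u) v)
| hrel_id_l x y (t : hterm x y) : hrel (TComp (TId y) t) t
| hrel_id_r x y (t : hterm x y) : hrel (TComp t (TId x)) t
| hrel_degen (x : X 0) (p : d_ 0 1 (s_ 0 0 x) = x) (q : d_ 0 0 (s_ 0 0 x) = x) :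
    hrel (TEdge p q) (TId x)
| hrel_simplex x y z (s : X 2)
    (p01 : d_ 0 1 (d_ 1 2 s) = x) (q01 : d_ 0 0 (d_ 1 2 s) = y)
    (p12 : d_ 0 1 (d_ 1 0 s) = y) (q12 : d_ 0 0 (d_ 1 0 s) = z)
    (p02 : d_ 0 1 (d_ 1 1 s) = x) (q02 : d_ 0 0 (d_ 1 1 s) = z) :
    hrel (TComp (TEdge p12 q12) (TEdge p01 q01)) (TEdge p02 q02).

Definition hHom (X : sSet) (x y : X 0) : Type := quot (@hrel X x y).

Lemma hcl_eq (X : sSet) (x y : X 0) (t u : hterm x y) :
  hrel t u -> qcl (@hrel X x y) t = qcl (@hrel X x y) u.
Proof.
move=> tu; rewrite /qcl.
have e : @hrel X x y t = @hrel X x y u.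
  apply: functional_extensionality => v; apply: propositional_extensionality.
  split=> H; first exact: hrel_trans (hrel_sym tu) H.
  exact: hrel_trans tu H.
move: (ex_intro _ _ _) (ex_intro _ _ _); rewrite e => H1 H2.
by congr exist; exact: proof_irrelevance.
Qed.

Lemma hrepr (X : sSet) (x y : X 0) (t : hterm x y) :
  hrel (qrepr (qcl (@hrel X x y) t)) t.
Proof.
by apply: qcl_inv; [move=> u; exact: hrel_refl | exact: qcl_repr].
Qed.

Definition hcomp (X : sSet) (x y z : X 0) (g : hHom y z) (f : hHom x y) :
  hHom x z := qcl (@hrel X x z) (TComp (qrepr g) (qrepr f)).

Lemma hcompE (X : sSet) (x y z : X 0) (t : hterm y z) (u : hterm x y) :
  hcomp (qcl (@hrel X y z) t) (qcl (@hrel X x y) u) = qcl (@hrel X x z) (TComp t u).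
Proof. by apply: hcl_eq; apply: hrel_comp; exact: hrepr. Qed.

Program Definition hcat (X : sSet) : Category :=
  @MkCategory (X 0) (@hHom X) (fun x => qcl (@hrel X x x) (TId x)) (@hcomp X)
    _ _ _.
Next Obligation.
rewrite -(qcl_repr h) -(qcl_repr g) -(qcl_repr f) !hcompE.
by apply: hcl_eq; exact: hrel_assoc.
Qed.
Next Obligation.
by rewrite -(qcl_repr f) hcompE; apply: hcl_eq; exact: hrel_id_l.
Qed.
Next Obligation.
by rewrite -(qcl_repr f) hcompE; apply: hcl_eq; exact: hrel_id_r.
Qed.

Definition hedge (X : sSet) (x y : X 0) (e : X 1)
    (p : d_ 0 1 e = x) (q : d_ 0 0 e = y) : @Hom (hcat X) x y :=
  qcl (@hrel X x y) (TEdge p q).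

Lemma arr_hedge (X : sSet) (x y x' y' : X 0) (e e' : X 1)
    (p : d_ 0 1 e = x) (q : d_ 0 0 e = y)
    (p' : d_ 0 1 e' = x') (q' : d_ 0 0 e' = y') :
  e = e' -> arr (hedge p q) = arr (hedge p' q').
Proof. by move=> ee; subst. Qed.

Lemma hedge_degen (X : sSet) (x : X 0) (e : X 1)
    (p : d_ 0 1 e = x) (q : d_ 0 0 e = x) :
  e = s_ 0 0 x -> hedge p q = cid (x : hcat X).
Proof. by move=> ee; subst e; apply: hcl_eq; exact: hrel_degen. Qed.

Lemma hedge_simplex (X : sSet) (x y z : X 0) (s : X 2) (e01 e12 e02 : X 1)
    (p01 : d_ 0 1 e01 = x) (q01 : d_ 0 0 e01 = y)
    (p12 : d_ 0 1 e12 = y) (q12 : d_ 0 0 e12 = z)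
    (p02 : d_ 0 1 e02 = x) (q02 : d_ 0 0 e02 = z) :
  d_ 1 2 s = e01 -> d_ 1 0 s = e12 -> d_ 1 1 s = e02 ->
  ccomp (hedge p12 q12) (hedge p01 q01) = hedge p02 q02.
Proof.
move=> E1 E2 E3; subst e01 e12 e02; rewrite /hedge /= hcompE.
by apply: hcl_eq; exact: hrel_simplex.
Qed.

Fixpoint heval (X : sSet) (D : Category) (ob : X 0 -> D)
    (ed : forall (x y : X 0) (e : X 1), d_ 0 1 e = x -> d_ 0 0 e = y ->
      Hom (ob x) (ob y))
    (x y : X 0) (t : hterm x y) : Hom (ob x) (ob y) :=
  match t with
  | TId x => cid (ob x)
  | TEdge x y e p q => ed x y e p q
  | TComp x y z t u => ccomp (heval ed t) (heval ed u)
  end.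

Lemma heval_rel (X : sSet) (D : Category) (ob : X 0 -> D)
    (ed : forall (x y : X 0) (e : X 1), d_ 0 1 e = x -> d_ 0 0 e = y ->
      Hom (ob x) (ob y)) :
  (forall x p q, ed x x (s_ 0 0 x) p q = cid (ob x)) ->
  (forall x y z (s : X 2) p01 q01 p12 q12 p02 q02,
    ccomp (ed y z (d_ 1 0 s) p12 q12) (ed x y (d_ 1 2 s) p01 q01)
      = ed x z (d_ 1 1 s) p02 q02) ->
  forall (x y : X 0) (t u : hterm x y), hrel t u -> heval ed t = heval ed u.
Proof.
move=> Hd Hs x y t u; elim=> {x y t u} //=.
- by move=> x y t u v _ -> _ ->.
- by move=> x y z t t' u u' _ -> _ ->.
- by move=> *; rewrite ccompA.
- by move=> *; rewrite ccomp1l.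
- by move=> *; rewrite ccomp1r.
Qed.

Program Definition hrec (X : sSet) (D : Category) (ob : X 0 -> D)
    (ed : forall (x y : X 0) (e : X 1), d_ 0 1 e = x -> d_ 0 0 e = y ->
      Hom (ob x) (ob y))
    (Hd : forall x p q, ed x x (s_ 0 0 x) p q = cid (ob x))
    (Hs : forall x y z (s : X 2) p01 q01 p12 q12 p02 q02,
      ccomp (ed y z (d_ 1 0 s) p12 q12) (ed x y (d_ 1 2 s) p01 q01)
        = ed x z (d_ 1 1 s) p02 q02) : Functor (hcat X) D :=
  @MkFunctor (hcat X) D ob (fun x y (f : hHom x y) => heval ed (qrepr f)) _ _.
Next Obligation. by rewrite (heval_rel Hd Hs (hrepr _)). Qed.
Next Obligation. by rewrite (heval_rel Hd Hs (hrepr _)). Qed.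

Lemma hrec_edge (X : sSet) (D : Category) (ob : X 0 -> D) ed Hd Hs
    (x y : X 0) (e : X 1) (p : d_ 0 1 e = x) (q : d_ 0 0 e = y) :
  fmap (@hrec X D ob ed Hd Hs) (hedge p q) = ed x y e p q.
Proof. by rewrite /= (heval_rel Hd Hs (hrepr _)). Qed.

Lemma src_degen (X : sSet) (x : X 0) : d_ 0 1 (s_ 0 0 x) = x.
Proof.
rewrite /face /degen -sactM -[RHS]sact1; congr (sact _ _).
by apply: Dhom_ext; case=> [[]].
Qed.

Lemma tgt_degen (X : sSet) (x : X 0) : d_ 0 0 (s_ 0 0 x) = x.
Proof.
rewrite /face /degen -sactM -[RHS]sact1; congr (sact _ _).
by apply: Dhom_ext; case=> [[]].
Qed.

Lemma hcat_ind (X : sSet) (P : forall x y : X 0, @Hom (hcat X) x y -> Prop) :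
  (forall x, P x x (@cid (hcat X) x)) ->
  (forall x y e p q, P x y (@hedge X x y e p q)) ->
  (forall x y z (g : @Hom (hcat X) y z) (f : @Hom (hcat X) x y),
     P y z g -> P x y f -> P x z (ccomp g f)) ->
  forall x y f, P x y f.
Proof.
move=> P1 Pe Pc x y f; rewrite -(qcl_repr f); elim: (qrepr f) => {x y f}.
- exact: P1.
- exact: Pe.
- by move=> x y z t Ht u Hu; rewrite -hcompE; exact: Pc Ht Hu.
Qed.

Lemma hext (X : sSet) (D : Category) (F G : Functor (hcat X) D) :
  (forall (x y : X 0) (e : X 1) (p : d_ 0 1 e = x) (q : d_ 0 0 e = y),
     arr (fmap F (hedge p q)) = arr (fmap G (hedge p q))) -> F = G.
Proof.
move=> H; apply: functor_ext; apply: hcat_ind => //.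
- move=> x; rewrite -(@hedge_degen X x _ (src_degen x) (tgt_degen x)) //.
- by move=> x y z g f Hg Hf; rewrite !fmapM; exact: arr_comp.
Qed.

Lemma h_map_face (X Y : sSet) (f : sMap X Y) n (i : 'I_n.+2) (e : X n.+1) (x : X n) :
  face i e = x -> face i (f n.+1 e) = f n x.
Proof. by move=> <-; rewrite /face smapN. Qed.

Program Definition h_map (X Y : sSet) (f : sMap X Y) : Functor (hcat X) (hcat Y) :=
  @hrec X (hcat Y) (fun x => f 0 x)
    (fun x y e p q => hedge (h_map_face f p) (h_map_face f q)) _ _.
Next Obligation. by apply: hedge_degen; rewrite /degen smapN. Qed.
Next Obligation.
by apply: (@hedge_simplex _ _ _ _ (f 2 s)); apply: h_map_face.
Qed.

Lemma h_map_edge (X Y : sSet) (f : sMap X Y) (x y : X 0) (e : X 1)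
    (p : d_ 0 1 e = x) (q : d_ 0 0 e = y) :
  fmap (h_map f) (hedge p q) = hedge (h_map_face f p) (h_map_face f q).
Proof. exact: hrec_edge. Qed.

Lemma h_map_id (X : sSet) : h_map (sid X) = fid.
Proof. by apply: hext => x y e p q; rewrite h_map_edge; exact: arr_hedge. Qed.

Lemma h_map_comp (X Y Z : sSet) (g : sMap Y Z) (f : sMap X Y) :
  h_map (g \os f) = h_map g \oc h_map f.
Proof.
apply: hext => x y e p q; rewrite h_map_edge.
by rewrite fmap_fcomp !h_map_edge; exact: arr_hedge.
Qed.

Lemma sprod_face (X Y : sSet) n (i : 'I_n.+2) (e : X n.+1) (f : Y n.+1)
    (x : X n) (y : Y n) :
  face i e = x -> face i f = y -> @face (X *s Y) n i (e, f) = (x, y).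
Proof. by move=> <- <-. Qed.

Ltac simplicial_id := rewrite /= /face /degen -?sactM; first
  [ by congr (sact _ _); apply: Dhom_ext; case=> [[|[|[|]]]]
  | by rewrite -[RHS]sact1; congr (sact _ _); apply: Dhom_ext;
       case=> [[|[|[|]]]] ].

#[local] Obligation Tactic := idtac.

(* f |-> (f, 1_y) *)
Program Definition h_inl (X Y : sSet) (y : Y 0) : Functor (hcat X) (hcat (X *s Y)) :=
  @hrec X (hcat (X *s Y)) (fun x => (x, y))
    (fun x x' e p q => @hedge (X *s Y) (x, y) (x', y) (e, s_ 0 0 y)
       (sprod_face p (src_degen y)) (sprod_face q (tgt_degen y))) _ _.
Next Obligation. by move=> *; exact: hedge_degen. Qed.
Next Obligation.
move=> X Y y ? ? ? s *; apply: (@hedge_simplex _ _ _ _ ((s, degen ord0 (s_ 0 0 y)) : (X *s Y) 2));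
  congr pair; simplicial_id.
Qed.

(* g |-> (1_x, g) *)
Program Definition h_inr (X Y : sSet) (x : X 0) : Functor (hcat Y) (hcat (X *s Y)) :=
  @hrec Y (hcat (X *s Y)) (fun y => (x, y))
    (fun y y' e p q => @hedge (X *s Y) (x, y) (x, y') (s_ 0 0 x, e)
       (sprod_face (src_degen x) p) (sprod_face (tgt_degen x) q)) _ _.
Next Obligation. by move=> *; exact: hedge_degen. Qed.
Next Obligation.
move=> X Y x ? ? ? s *; apply: (@hedge_simplex _ _ _ _ ((degen ord0 (s_ 0 0 x), s) : (X *s Y) 2));
  congr pair; simplicial_id.
Qed.

Lemma h_inr_inl_edge (X Y : sSet) (x x' : X 0) (y y' : Y 0) (e : X 1) (f : Y 1)
    (p : d_ 0 1 e = x) (q : d_ 0 0 e = x') (r : d_ 0 1 f = y) (s : d_ 0 0 f = y') :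
  ccomp (fmap (h_inr Y x') (hedge r s)) (fmap (h_inl X y) (hedge p q)) =
  @hedge (X *s Y) (x, y) (x', y') (e, f) (sprod_face p r) (sprod_face q s).
Proof.
rewrite !hrec_edge; subst x x' y y'.
apply: (@hedge_simplex _ _ _ _ ((s_ 1 1 e, s_ 1 0 f) : (X *s Y) 2));
  congr pair; simplicial_id.
Qed.

Lemma h_inl_inr_edge (X Y : sSet) (x x' : X 0) (y y' : Y 0) (e : X 1) (f : Y 1)
    (p : d_ 0 1 e = x) (q : d_ 0 0 e = x') (r : d_ 0 1 f = y) (s : d_ 0 0 f = y') :
  ccomp (fmap (h_inl X y') (hedge p q)) (fmap (h_inr Y x) (hedge r s)) =
  @hedge (X *s Y) (x, y) (x', y') (e, f) (sprod_face p r) (sprod_face q s).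
Proof.
rewrite !hrec_edge; subst x x' y y'.
apply: (@hedge_simplex _ _ _ _ ((s_ 1 0 e, s_ 1 1 f) : (X *s Y) 2));
  congr pair; simplicial_id.
Qed.

Lemma h_interchange (X Y : sSet) (x x' : hcat X) (y y' : hcat Y)
    (f : Hom x x') (g : Hom y y') :
  ccomp (fmap (h_inr Y x') g) (fmap (h_inl X y) f) =
  ccomp (fmap (h_inl X y') f) (fmap (h_inr Y x) g).
Proof.
move: x x' f y y' g; apply: hcat_ind.
- by move=> x y y' g; rewrite !fmap1 ccomp1l ccomp1r.
- move=> x x' e p q; apply: hcat_ind.
  + by move=> y; rewrite !fmap1 ccomp1l ccomp1r.
  + by move=> y y' f r s; rewrite h_inr_inl_edge h_inl_inr_edge.
  + move=> y1 y2 y3 g f Hg Hf.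
    by rewrite !fmapM -[LHS]ccompA Hf [LHS]ccompA Hg ccompA.
- move=> x1 x2 x3 g f Hg Hf y y' k.
  by rewrite !fmapM [LHS]ccompA Hg -[LHS]ccompA Hf ccompA.
Qed.

Definition h_prod_map (X Y : sSet) (p q : hcat X *c hcat Y) (f : Hom p q) :
    @Hom (hcat (X *s Y)) (p.1, p.2) (q.1, q.2) :=
  ccomp (fmap (h_inr Y q.1) f.2) (fmap (h_inl X p.2) f.1).

Lemma h_prod_map1 (X Y : sSet) (p : hcat X *c hcat Y) :
  h_prod_map (cid p) = cid ((p.1, p.2) : hcat (X *s Y)).
Proof.
rewrite /h_prod_map [(cid p).1]/(cid p.1) [(cid p).2]/(cid p.2) !fmap1.
exact: ccomp1l.
Qed.

Lemma ccomp_middle (C : Category) (x y1 y2 y2' y3 z : C) (g' : Hom y3 z)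
    (g : Hom y2 y3) (f' : Hom y1 y2) (f : Hom x y1) (k : Hom y2' y3)
    (l : Hom y1 y2') : ccomp g f' = ccomp k l ->
  ccomp (ccomp g' g) (ccomp f' f) = ccomp (ccomp g' k) (ccomp l f).
Proof. by move=> e; rewrite -!ccompA; congr ccomp; rewrite !ccompA e. Qed.

Lemma h_prod_mapM (X Y : sSet) (p q r : hcat X *c hcat Y)
    (g : Hom q r) (f : Hom p q) :
  h_prod_map (ccomp g f) = ccomp (h_prod_map g) (h_prod_map f).
Proof.
rewrite /h_prod_map [(ccomp g f).1]/(ccomp g.1 f.1).
rewrite [(ccomp g f).2]/(ccomp g.2 f.2) !fmapM.
by apply: ccomp_middle; exact: h_interchange.
Qed.

Definition h_prod_inv (X Y : sSet) : Functor (hcat X *c hcat Y) (hcat (X *s Y)) :=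
  @MkFunctor (hcat X *c hcat Y) (hcat (X *s Y)) (fun p => (p.1, p.2))
    (@h_prod_map X Y) (@h_prod_map1 X Y) (@h_prod_mapM X Y).

Lemma h_fst_inl (X Y : sSet) (y : Y 0) : h_map (sfst X Y) \oc h_inl X y = fid.
Proof.
apply: hext => a b e p q.
by rewrite fmap_fcomp hrec_edge h_map_edge; exact: arr_hedge.
Qed.

Lemma h_snd_inr (X Y : sSet) (x : X 0) : h_map (ssnd X Y) \oc h_inr Y x = fid.
Proof.
apply: hext => a b e p q.
by rewrite fmap_fcomp hrec_edge h_map_edge; exact: arr_hedge.
Qed.

Lemma h_fst_inr (X Y : sSet) (x : X 0) :
  h_map (sfst X Y) \oc h_inr Y x = fconst (hcat Y) (x : hcat X).
Proof.
apply: hext => a b e p q.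
rewrite fmap_fcomp hrec_edge h_map_edge; congr arr; exact: hedge_degen.
Qed.

Lemma h_snd_inl (X Y : sSet) (y : Y 0) :
  h_map (ssnd X Y) \oc h_inl X y = fconst (hcat X) (y : hcat Y).
Proof.
apply: hext => a b e p q.
rewrite fmap_fcomp hrec_edge h_map_edge; congr arr; exact: hedge_degen.
Qed.

Lemma fmap_eq (C D : Category) (F G : Functor C D) (x y : C) (f : Hom x y) :
  F = G -> arr (fmap F f) = arr (fmap G f).
Proof. by move=> ->. Qed.

Lemma h_fst_prod_inv (X Y : sSet) : h_map (sfst X Y) \oc h_prod_inv X Y = ffst.
Proof.
apply: functor_ext => p q f; rewrite fmap_fcomp.
rewrite [fmap (h_prod_inv X Y) f]/(ccomp (fmap (h_inr Y q.1) f.2)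
  (fmap (h_inl X p.2) f.1)) fmapM.
rewrite [fmap ffst f]/(f.1) -[X in _ = arr X]ccomp1l; apply: arr_comp.
- exact: (fmap_eq f.2 (h_fst_inr Y q.1)).
- exact: (fmap_eq f.1 (h_fst_inl X p.2)).
Qed.

Lemma h_snd_prod_inv (X Y : sSet) : h_map (ssnd X Y) \oc h_prod_inv X Y = fsnd.
Proof.
apply: functor_ext => p q f; rewrite fmap_fcomp.
rewrite [fmap (h_prod_inv X Y) f]/(ccomp (fmap (h_inr Y q.1) f.2)
  (fmap (h_inl X p.2) f.1)) fmapM.
rewrite [fmap fsnd f]/(f.2) -[X in _ = arr X]ccomp1r; apply: arr_comp.
- exact: (fmap_eq f.2 (h_snd_inr Y q.1)).
- exact: (fmap_eq f.1 (h_snd_inl X p.2)).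
Qed.

Lemma h_prod_invK (X Y : sSet) :
  h_prod_inv X Y \oc <| h_map (sfst X Y), h_map (ssnd X Y) |> = fid.
Proof.
apply: hext => -[x y] [x' y'] [e f] p q.
rewrite fmap_fcomp [fmap (h_prod_inv X Y) _]/(ccomp
  (fmap (h_inr Y x') (fmap (h_map (ssnd X Y)) (hedge p q)))
  (fmap (h_inl X y) (fmap (h_map (sfst X Y)) (hedge p q)))).
rewrite !h_map_edge.
have H := h_inr_inl_edge (h_map_face (sfst X Y) p) (h_map_face (sfst X Y) q)
  (h_map_face (ssnd X Y) p) (h_map_face (ssnd X Y) q).
by apply: etrans (congr1 (@arr _ _ _) H) _; exact: arr_hedge.
Qed.

(* With [h_prod_inv], this is the preservation of binary products by h, which
   underlies horizontal composition below. *)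
Theorem h_prod_iso (X Y : sSet) :
  is_iso_functor <| h_map (sfst X Y), h_map (ssnd X Y) |>.
Proof.
exists (h_prod_inv X Y); split; first exact: h_prod_invK.
apply: fpair_ext.
- by rewrite fcompA fst_fpair h_fst_prod_inv fcomp1r.
- by rewrite fcompA snd_fpair h_snd_prod_inv fcomp1r.
Qed.

Lemma h_prod_ext (X Y : sSet) (C : Category) (F G : Functor C (hcat (X *s Y))) :
  h_map (sfst X Y) \oc F = h_map (sfst X Y) \oc G ->
  h_map (ssnd X Y) \oc F = h_map (ssnd X Y) \oc G -> F = G.
Proof.
move=> e1 e2; rewrite -(fcomp1l F) -(fcomp1l G) -h_prod_invK -!fcompA.
by rewrite !fpair_comp e1 e2.
Qed.

Definition h_map2 (X Y Z : sSet) (f : sMap (X *s Y) Z) :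
  Functor (hcat X *c hcat Y) (hcat Z) := h_map f \oc h_prod_inv X Y.

Definition ordcat (n : nat) : Category :=
  @MkCategory 'I_n.+1 (fun i j => i <= j) (fun i => leqnn i)
    (fun _ _ _ jk ij => leq_trans ij jk)
    (fun _ _ _ _ _ _ _ => bool_irrelevance _ _)
    (fun _ _ _ => bool_irrelevance _ _) (fun _ _ _ => bool_irrelevance _ _).

Definition ordfun m n (f : Dhom m n) : Functor (ordcat m) (ordcat n) :=
  @MkFunctor (ordcat m) (ordcat n) f (fun _ _ ij => Dmono f ij)
    (fun _ => bool_irrelevance _ _) (fun _ _ _ _ _ => bool_irrelevance _ _).

Program Definition nerve (C : Category) : sSet :=
  @MkSSet (fun n => Functor (ordcat n) C) (fun _ _ f F => F \oc ordfun f) _ _.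
Next Obligation. by move=> C n F; exact: functor_ext. Qed.
Next Obligation. by move=> C m n p g f F; exact: functor_ext. Qed.

Program Definition nerve_map (C D : Category) (F : Functor C D) :
    sMap (nerve C) (nerve D) :=
  @MkSMap (nerve C) (nerve D) (fun n (G : Functor (ordcat n) C) => F \oc G) _.
Next Obligation. by move=> *; exact: functor_ext. Qed.

Definition Dvertex n (i : 'I_n.+1) : Dhom 0 n :=
  @MkDhom 0 n (fun=> i) (fun _ _ _ => leqnn i).

Lemma Dedge_mono n (i j : 'I_n.+1) (ij : i <= j) (a b : 'I_2) :
  a <= b -> (if a == 0 :> nat then i else j) <= (if b == 0 :> nat then i else j).
Proof. by case: a b => [[|[|//]] Ha] [[|[|//]] Hb]. Qed.

Definition Dedge n (i j : 'I_n.+1) (ij : i <= j) : Dhom 1 n :=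
  @MkDhom 1 n (fun a => if a == 0 :> nat then i else j) (Dedge_mono ij).

Definition Dtriangle n (i j k : 'I_n.+1) (ij : i <= j) (jk : j <= k) : Dhom 2 n.
Proof.
exists (fun a : 'I_3 => nth k [:: i; j] a).
by move=> [[|[|[|//]]] Ha] [[|[|[|//]]] Hb] //= _; exact: leq_trans ij jk.
Defined.

Lemma edge_src (X : sSet) n (x : X n) (i j : 'I_n.+1) (ij : i <= j) :
  d_ 0 1 (sact (Dedge ij) x) = sact (Dvertex i) x.
Proof.
by rewrite /face -sactM; congr (sact _ _); apply: Dhom_ext; case=> [[]].
Qed.

Lemma edge_tgt (X : sSet) n (x : X n) (i j : 'I_n.+1) (ij : i <= j) :
  d_ 0 0 (sact (Dedge ij) x) = sact (Dvertex j) x.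
Proof.
by rewrite /face -sactM; congr (sact _ _); apply: Dhom_ext; case=> [[]].
Qed.

Program Definition h_unit_simp (X : sSet) n (x : X n) : Functor (ordcat n) (hcat X) :=
  @MkFunctor (ordcat n) (hcat X) (fun i => sact (Dvertex i) x)
    (fun i j ij => hedge (edge_src x ij) (edge_tgt x ij)) _ _.
Next Obligation.
move=> X n x i; apply: hedge_degen.
rewrite /degen -sactM; congr (sact _ _).
by apply: Dhom_ext; case=> [[|[|//]]].
Qed.
Next Obligation.
move=> X n x i j k jk ij; symmetry.
apply: (@hedge_simplex _ _ _ _ (sact (Dtriangle ij jk) x));
  rewrite /face -sactM; congr (sact _ _);
  by apply: Dhom_ext; case=> [[|[|//]]].
Qed.

Program Definition h_unit (X : sSet) : sMap X (nerve (hcat X)) :=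
  @MkSMap X (nerve (hcat X)) (fun n x => h_unit_simp x) _.
Next Obligation.
move=> X m n f x; apply: functor_ext => i j ij; apply: arr_hedge.
rewrite -sactM; congr (sact _ _); apply: Dhom_ext.
by case=> [[|[|//]]].
Qed.

Lemma h_unit_natural (X Y : sSet) (g : sMap X Y) :
  nerve_map (h_map g) \os h_unit X = h_unit Y \os g.
Proof.
apply: sMap_ext => n x; apply: functor_ext => i j ij.
rewrite fmap_fcomp [fmap (h_unit X n x) ij]/(hedge _ _) h_map_edge.
by apply: arr_hedge; rewrite smapN.
Qed.

Lemma ordcat_eq n (i j : ordcat n) : (i : 'I_n.+1) = j :> nat -> i = j.
Proof. exact: val_inj. Qed.

Lemma ordhom_arr (C : Category) (n m : nat) (F : Functor (ordcat n) C)
    (G : Functor (ordcat m) C) (i j : ordcat n) (i' j' : ordcat m)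
    (f : Dhom m n) (ij : Hom i j) (ij' : Hom i' j') :
  G = F \oc ordfun f -> f i' = i -> f j' = j ->
  arr (fmap G ij') = arr (fmap F ij).
Proof.
move=> -> e1 e2; subst i j; rewrite fmap_fcomp; congr (arr (fmap F _)).
exact: bool_irrelevance.
Qed.

Section Transpose.
Context (X : sSet) (C : Category) (f : sMap X (nerve C)).

Let ob (x : X 0) : C := (f 0 x : Functor _ _) ord0.

Let o0 : ordcat 1 := @Ordinal 2 0 isT.
Let o1 : ordcat 1 := @Ordinal 2 1 isT.
Let o01 : Hom o0 o1 := isT.

Lemma transpose_src (e : X 1) (x : X 0) :
  d_ 0 1 e = x -> (f 1 e : Functor _ _) o0 = ob x.
Proof.
move=> <-; rewrite /ob /face smapN /=; congr ((f 1 e : Functor _ _) _).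
exact: val_inj.
Qed.

Lemma transpose_tgt (e : X 1) (x : X 0) :
  d_ 0 0 e = x -> (f 1 e : Functor _ _) o1 = ob x.
Proof.
move=> <-; rewrite /ob /face smapN /=; congr ((f 1 e : Functor _ _) _).
exact: val_inj.
Qed.

Let ed (x y : X 0) (e : X 1) (p : d_ 0 1 e = x) (q : d_ 0 0 e = y) :
    Hom (ob x) (ob y) :=
  hcast (transpose_src p) (transpose_tgt q) (fmap (f 1 e : Functor _ _) o01).

Lemma transpose_degen (x : X 0) p q : ed (x := x) (y := x) (e := s_ 0 0 x) p q = cid (ob x).
Proof.
apply: arr_inj; rewrite arr_hcast /ob -fmap1.
by apply: (ordhom_arr (f := Ddegen (@Ordinal 1 0 isT)));
  [rewrite /degen smapN | exact: ordcat_eq | exact: ordcat_eq].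
Qed.

Lemma transpose_simplex x y z (s : X 2) p01 q01 p12 q12 p02 q02 :
  ccomp (ed (x := y) (y := z) (e := d_ 1 0 s) p12 q12)
        (ed (x := x) (y := y) (e := d_ 1 2 s) p01 q01)
    = ed (x := x) (y := z) (e := d_ 1 1 s) p02 q02.
Proof.
pose a0 : ordcat 2 := @Ordinal 3 0 isT.
pose a1 : ordcat 2 := @Ordinal 3 1 isT.
pose a2 : ordcat 2 := @Ordinal 3 2 isT.
pose a01 : Hom a0 a1 := isT. pose a12 : Hom a1 a2 := isT.
apply: arr_inj; rewrite arr_hcast.
transitivity (arr (fmap (f 2 s : Functor _ _) (ccomp a12 a01))).
  rewrite fmapM; apply: arr_comp; rewrite arr_hcast.
  - by apply: (ordhom_arr (f := Dface (@Ordinal 3 0 isT)));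
      [rewrite /face smapN | exact: ordcat_eq | exact: ordcat_eq].
  - by apply: (ordhom_arr (f := Dface (@Ordinal 3 2 isT)));
      [rewrite /face smapN | exact: ordcat_eq | exact: ordcat_eq].
symmetry; apply: (ordhom_arr (f := Dface (@Ordinal 3 1 isT)));
  [by rewrite /face smapN | exact: ordcat_eq | exact: ordcat_eq].
Qed.

Definition h_transpose : Functor (hcat X) C := hrec transpose_degen transpose_simplex.

Lemma h_transposeP : nerve_map h_transpose \os h_unit X = f.
Proof.
apply: sMap_ext => n x; apply: functor_ext => i j ij.
rewrite fmap_fcomp [fmap (h_unit X n x) ij]/(hedge _ _) hrec_edge arr_hcast.
by apply: (ordhom_arr (f := Dedge ij)); rewrite ?smapN.
Qed.

Lemma h_transpose_uniq (F : Functor (hcat X) C) :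
  nerve_map F \os h_unit X = f -> h_transpose = F.
Proof.
move=> eF; apply: hext => x y e p q; rewrite hrec_edge arr_hcast -eF.
rewrite fmap_fcomp; apply: (@arr_fmap _ _ F); apply: arr_hedge.
by rewrite -[RHS]sact1; congr (sact _ _); apply: Dhom_ext; case=> [[|[|//]]].
Qed.

End Transpose.

(* [h_unit X] is a universal arrow from [X] to the nerve functor, natural with
   respect to [h_map] by [h_unit_natural]: h is left adjoint to the nerve. *)
Theorem h_left_adjoint_nerve (X : sSet) (C : Category) (f : sMap X (nerve C)) :
  exists! F : Functor (hcat X) C, nerve_map F \os h_unit X = f.
Proof.
by exists (h_transpose f); split; [exact: h_transposeP | exact: h_transpose_uniq].
Qed.

(* Strict 2-categories, as categories enriched in categories. *)
Record TwoCat := MkTwoCat {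
  t_ob :> Type;
  t_hom :> t_ob -> t_ob -> Category;
  t_id : forall A, t_hom A A;
  t_comp : forall A B C, Functor (t_hom B C *c t_hom A B) (t_hom A C);
  t_compA : forall A B C D,
    t_comp A B D \oc fcross (t_comp B C D) (@fid (t_hom A B)) =
    t_comp A C D \oc <| ffst \oc ffst, t_comp A B C \oc <| fsnd \oc ffst, fsnd |> |>;
  t_comp1l : forall A B,
    t_comp A B B \oc <| fconst (t_hom A B) (t_id B), fid |> = fid;
  t_comp1r : forall A B,
    t_comp A A B \oc <| fid, fconst (t_hom A B) (t_id A) |> = fid }.

Arguments t_id {t} A.
Arguments t_comp {t A B C}.

(* K(A', A) * K(X, X') * K(A, X) -> K(A', X'), (u, v, w) |-> v o w o u: the
   action of 1-cells and 2-cells on hom-categories. *)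
Definition t_hom_act (K : TwoCat) (A A' X X' : K) :
    Functor (K A' A *c K X X' *c K A X) (K A' X') :=
  t_comp \oc <| t_comp \oc <| fsnd \oc ffst, fsnd |>, ffst \oc ffst |>.

Definition fmiddle (C1 C2 D1 D2 : Category) :
    Functor ((C1 *c C2) *c (D1 *c D2)) ((C1 *c D1) *c (C2 *c D2)) :=
  <| fcross ffst ffst, fcross fsnd fsnd |>.

Definition fswap (C D : Category) : Functor (C *c D) (D *c C) := <| fsnd, ffst |>.

(* A 2-category [K] is cartesian closed, as witnessed by a terminal object,
   2-functors [prd] : K * K -> K and [exp] : K^op * K -> K (with actions
   [prd2] and [exp2] on hom-categories), and isomorphisms of categories
     K(A, one) ~ 1,  K(A, prd B C) ~ K(A, B) * K(A, C),
     K(A, exp B C) ~ K(prd A B, C)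
   which are 2-natural in all variables.  [exp B C] is the exponential C^B. *)
Record is_cartesian_closed (K : TwoCat) (one : K) (prd exp : K -> K -> K)
    (prd2 : forall B B' C C' : K,
      Functor (K B B' *c K C C') (K (prd B C) (prd B' C')))
    (exp2 : forall B B' C C' : K,
      Functor (K B' B *c K C C') (K (exp B C) (exp B' C')))
    (pr : forall A B C : K, Functor (K A (prd B C)) (K A B *c K A C))
    (cur : forall A B C : K, Functor (K A (exp B C)) (K (prd A B) C)) : Prop :=
  IsCartesianClosed {
    cc_prd_id : forall B C : K, prd2 B B C C (t_id B, t_id C) = t_id (prd B C);
    cc_prd_comp : forall B B' B'' C C' C'' : K,
      prd2 B B'' C C'' \oc fcross t_comp t_comp =
      t_comp \oc fcross (prd2 B' B'' C' C'') (prd2 B B' C C') \oc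
        @fmiddle (K B' B'') (K B B') (K C' C'') (K C C');
    cc_exp_id : forall B C : K, exp2 B B C C (t_id B, t_id C) = t_id (exp B C);
    cc_exp_comp : forall B B' B'' C C' C'' : K,
      exp2 B B'' C C'' \oc fcross (t_comp \oc @fswap (K B'' B') (K B' B)) t_comp =
      t_comp \oc fcross (exp2 B' B'' C' C'') (exp2 B B' C C') \oc
        @fmiddle (K B'' B') (K B' B) (K C' C'') (K C C');
    cc_one_iso : forall A : K, is_iso_functor (to_cat1 (K A one));
    cc_prd_iso : forall A B C : K, is_iso_functor (pr A B C);
    cc_exp_iso : forall A B C : K, is_iso_functor (cur A B C);
    cc_one_natural : forall A A' : K,
      to_cat1 (K A' one) \oc
        t_comp \oc @fswap (K A' A) (K A one) =
      fsnd \oc fcross (@fid (K A' A)) (to_cat1 (K A one));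
    cc_prd_natural : forall A A' B B' C C' : K,
      pr A' B' C' \oc t_hom_act A A' (prd B C) (prd B' C') \oc
        fcross (fcross (@fid (K A' A)) (prd2 B B' C C')) fid =
      <| t_hom_act A A' B B' \oc
           fcross (fcross fid ffst) (ffst \oc pr A B C),
         t_hom_act A A' C C' \oc
           fcross (fcross fid fsnd) (fsnd \oc pr A B C) |>;
    cc_exp_natural : forall A A' B B' C C' : K,
      cur A' B' C' \oc t_hom_act A A' (exp B C) (exp B' C') \oc
        fcross (fcross (@fid (K A' A)) (exp2 B B' C C')) fid =
      t_hom_act (prd A B) (prd A' B') C C' \oc
        fcross <| prd2 A' A B' B \oc fcross fid ffst, fsnd \oc fsnd |>
              (cur A B C) }.

(* The n-simplices of [sexp A B] are maps out of [A *s Delta n]; all the maps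
   below are the identity on the [Delta n] coordinate. *)

Program Definition sexp_comp (A B C : sSet) : sMap (sexp B C *s sexp A B) (sexp A C) :=
  @MkSMap (sexp B C *s sexp A B) (sexp A C)
    (fun n (gf : (sexp B C *s sexp A B) n) =>
      scomp gf.1 (spair gf.2 (ssnd A (Delta n)))) _.
Next Obligation. by move=> A B C m n f [g h]; apply: sMap_ext => k [a s]. Qed.

Definition hom' (A B : sSet) : Category := hcat (sexp A B).

(* A vertex of B^A is a map A * Delta 0 -> B. *)
Definition hom'_id (A : sSet) : hom' A A := sfst A (Delta 0).

Definition hom'_comp (A B C : sSet) : Functor (hom' B C *c hom' A B) (hom' A C) :=
  h_map2 (sexp_comp A B C).

Lemma h_map2_pair (X Y Z W : sSet) (g : sMap (X *s Y) Z) (f1 : sMap W X) (f2 : sMap W Y) :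
  h_map2 g \oc <| h_map f1, h_map f2 |> = h_map (g \os spair f1 f2).
Proof.
rewrite h_map_comp -fcompA; congr fcomp; apply: h_prod_ext.
- rewrite fcompA h_fst_prod_inv fst_fpair -h_map_comp; congr h_map.
  exact: sMap_ext.
- rewrite fcompA h_snd_prod_inv snd_fpair -h_map_comp; congr h_map.
  exact: sMap_ext.
Qed.

Lemma h_map_prod_inv_pair (X Y Z W : sSet) (g : sMap (X *s Y) Z)
    (f1 : sMap W X) (f2 : sMap W Y) :
  h_map g \oc (h_prod_inv X Y \oc <| h_map f1, h_map f2 |>) =
  h_map (g \os spair f1 f2).
Proof. by rewrite fcompA; exact: h_map2_pair. Qed.

(* Functors out of a product of three categories h X, compared after
   precomposition with the isomorphism from the h of the product. *)
Lemma h_prod3_ext (X Y Z : sSet) (C : Category)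
    (F G : Functor (hcat X *c hcat Y *c hcat Z) C) :
  let p1 := h_map (sfst X Y \os sfst (X *s Y) Z) in
  let p2 := h_map (ssnd X Y \os sfst (X *s Y) Z) in
  let p3 := h_map (ssnd (X *s Y) Z) in
  F \oc <| <| p1, p2 |>, p3 |> = G \oc <| <| p1, p2 |>, p3 |> -> F = G.
Proof.
move=> p1 p2 p3.
pose H := h_prod_inv (X *s Y) Z \oc fcross (h_prod_inv X Y) (@fid (hcat Z)).
have E1 : h_map (sfst (X *s Y) Z) \oc H = h_prod_inv X Y \oc ffst.
  by rewrite /H fcompA h_fst_prod_inv fst_fpair.
have E2 : p3 \oc H = fsnd.
  by rewrite /H fcompA h_snd_prod_inv snd_fpair fcomp1l.
have HK : <| <| p1, p2 |>, p3 |> \oc H = fid.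
  rewrite !fpair_comp E2 /p1 /p2 !h_map_comp -!fcompA !E1.
  rewrite !fcompA h_fst_prod_inv h_snd_prod_inv.
  apply: fpair_ext; [apply: fpair_ext|];
    by rewrite ?fst_fpair ?snd_fpair ?fst_fpair fcomp1r.
move=> e; rewrite -(fcomp1r F) -(fcomp1r G) -HK.
by rewrite !(fcompA _ _ H) e.
Qed.

Lemma hom'_compA (A B C D : sSet) :
  hom'_comp A B D \oc fcross (hom'_comp B C D) (@fid (hom' A B)) =
  hom'_comp A C D \oc
    <| ffst \oc ffst, hom'_comp A B C \oc <| fsnd \oc ffst, fsnd |> |>.
Proof.
apply: h_prod3_ext; rewrite /fcross -!fcompA !fpair_comp -!fcompA.
rewrite !fst_fpair !snd_fpair fcomp1l !fpair_comp -!fcompA !fst_fpair !snd_fpair.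
rewrite !h_map_prod_inv_pair; congr h_map.
by apply: sMap_ext => n [[h g] f]; apply: sMap_ext => k [a s].
Qed.

Definition Dto0 n : Dhom n 0 :=
  @MkDhom n 0 (fun=> ord0) (fun _ _ _ => leqnn _).

Program Definition sconst (X Y : sSet) (y : Y 0) : sMap X Y :=
  @MkSMap X Y (fun n _ => sact (Dto0 n) y) _.
Next Obligation. by move=> X Y y m n f x; rewrite -sactM. Qed.

Lemma h_sconst (X Y : sSet) (y : Y 0) :
  h_map (sconst X y) = fconst (hcat X) (y : hcat Y).
Proof.
have e0 : sact (Dto0 0) y = y.
  by rewrite -[RHS]sact1; congr (sact _ _); apply: Dhom_ext; case=> [[]].
apply: hext => a b e p q; rewrite h_map_edge.
have src : d_ 0 1 (sact (Dto0 1) y) = y by rewrite /face -sactM -[RHS]e0.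
have tgt : d_ 0 0 (sact (Dto0 1) y) = y by rewrite /face -sactM -[RHS]e0.
transitivity (arr (hedge src tgt)); first exact: arr_hedge.
congr arr; apply: hedge_degen.
rewrite /degen; congr (sact _ _); apply: Dhom_ext.
by case=> [[|[|//]]].
Qed.

Lemma hom'_comp1l (A B : sSet) :
  hom'_comp A B B \oc <| fconst (hom' A B) (hom'_id B), fid |> = fid.
Proof.
rewrite -h_sconst -h_map_id /hom'_comp h_map2_pair.
by congr h_map; apply: sMap_ext => n f; apply: sMap_ext.
Qed.

Lemma hom'_comp1r (A B : sSet) :
  hom'_comp A A B \oc <| fid, fconst (hom' A B) (hom'_id A) |> = fid.
Proof.
rewrite -h_sconst -h_map_id /hom'_comp h_map2_pair.
by congr h_map; apply: sMap_ext => n f; apply: sMap_ext => k [a s].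
Qed.

Definition qCat2 : TwoCat :=
  @MkTwoCat QCat (fun A B => hom' A B) (fun A => hom'_id A)
    (fun A B C => hom'_comp A B C) (fun A B C D => hom'_compA A B C D)
    (fun A B => hom'_comp1l A B) (fun A B => hom'_comp1r A B).

(* (u, v) |-> u * v *)
Program Definition sprod_act (B B' C C' : sSet) :
    sMap (sexp B B' *s sexp C C') (sexp (B *s C) (B' *s C')) :=
  @MkSMap (sexp B B' *s sexp C C') (sexp (B *s C) (B' *s C'))
    (fun n (uv : (sexp B B' *s sexp C C') n) =>
      @MkSMap (B *s C *s Delta n) (B' *s C')
        (fun m (p : (B *s C *s Delta n) m) =>
          (uv.1 m (p.1.1, p.2), uv.2 m (p.1.2, p.2))) _) _.
Next Obligation. by move=> B B' C C' n [u v] m k f p /=; rewrite -!smapN. Qed.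
Next Obligation. by move=> B B' C C' m n f [u v]; exact: sMap_ext. Qed.

(* (u, v) |-> (w |-> v o w o u) *)
Program Definition sexp_act2 (B B' C C' : sSet) :
    sMap (sexp B' B *s sexp C C') (sexp (sexp B C) (sexp B' C')) :=
  @MkSMap (sexp B' B *s sexp C C') (sexp (sexp B C) (sexp B' C'))
    (fun n (uv : (sexp B' B *s sexp C C') n) =>
      @MkSMap (sexp B C *s Delta n) (sexp B' C')
        (fun m (p : (sexp B C *s Delta n) m) =>
           sexp_comp B' C C' m (sact p.2 uv.2,
             sexp_comp B' B C m (p.1, sact p.2 uv.1))) _) _.
Next Obligation.
move=> B B' C C' n [u v] m k f [w s] /=.
by apply: sMap_ext => l [b t].
Qed.
Next Obligation.
move=> B B' C C' m n f [u v]; apply: sMap_ext => l [w s].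
by apply: sMap_ext => k [b t].
Qed.

Program Definition sexp_postcomp (A X Y : sSet) (g : sMap X Y) : sMap (sexp A X) (sexp A Y) :=
  @MkSMap (sexp A X) (sexp A Y) (fun n (f : sMap (A *s Delta n) X) => g \os f) _.
Next Obligation. by move=> A X Y g m n f u; exact: sMap_ext. Qed.

(* The canonical isomorphism (C^B)^A -> C^(A * B). *)
Program Definition suncurry (A B C : sSet) :
    sMap (sexp A (sexp B C)) (sexp (A *s B) C) :=
  @MkSMap (sexp A (sexp B C)) (sexp (A *s B) C)
    (fun n (f : sMap (A *s Delta n) (sexp B C)) =>
      @MkSMap (A *s B *s Delta n) C
        (fun m (p : (A *s B *s Delta n) m) =>
          (f m (p.1.1, p.2) : sMap _ _) m (p.1.2, Did m)) _) _.
Next Obligation.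
move=> A B C n f m k g [[a b] s] /=.
have := smapN f g ((a, s) : (A *s Delta n) k); rewrite /= => ->.
by rewrite -smapN.
Qed.
Next Obligation. by move=> A B C m n f u; apply: sMap_ext. Qed.

Definition prd_act (B B' C C' : sSet) :
    Functor (hom' B B' *c hom' C C') (hom' (B *s C) (B' *s C')) :=
  h_map2 (sprod_act B B' C C').

Definition exp_act (B B' C C' : sSet) :
    Functor (hom' B' B *c hom' C C') (hom' (sexp B C) (sexp B' C')) :=
  h_map2 (sexp_act2 B B' C C').

Definition hom'_pair (A B C : sSet) :
    Functor (hom' A (B *s C)) (hom' A B *c hom' A C) :=
  <| h_map (sexp_postcomp A (sfst B C)), h_map (sexp_postcomp A (ssnd B C)) |>.

Definition hom'_uncurry (A B C : sSet) :
    Functor (hom' A (sexp B C)) (hom' (A *s B) C) :=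
  h_map (suncurry A B C).

(* Main.v *)
Require Import Defs.
From mathcomp Require Import all_boot zify.
From mathcomp Require classical_sets.
From Stdlib Require Import FunctionalExtensionality PropExtensionality.
From Stdlib Require Import ProofIrrelevance.
From Stdlib Require Import Classical ClassicalEpsilon.

Set Implicit Arguments.
Unset Strict Implicit.
Unset Printing Implicit Defensive.

(** The only substantial point is that Z^X is a quasi-category when Z is, i.e.
    that every map X * horn k -> Z with 0 < k < n extends to X * Delta n.  Take
    by Zorn's lemma a maximal partial extension among those whose domain is
    closed under the following operation on simplices (x, g): let v be the last
    vertex with g v < k, repeat v, and send the new copy of v to k.  If some
    (x, g) is missing from the domain, choose it of minimal dimension, and then
    with as few vertices below k as possible.  Let y be the simplex obtained
    from (x, g) by the operation, and c = v + 1 the position of the new vertex.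
    The c-th face of y is (x, g); the v-th face is (x, g') where g' raises g v
    to k, so it has fewer vertices below k; every other face comes from a face
    of (x, g) by the operation.  So all faces of y but the c-th lie in the
    domain, and filling an inner horn of Z enlarges it to contain y, which
    contradicts maximality.

    The 2-categorical identities involve functors out of products of
    categories h S.  Since h preserves products, precomposing with the
    projections reduces each of them to an equality of simplicial maps. *)

(** * Closure of quasi-categories under finite products *)

Lemma delta0_qcat : is_qcat (Delta 0).
Proof.
move=> n k _ _ _ f; exists (@sconst (Delta n) (Delta 0) (Did 0)).
by apply: sMap_ext => m x; apply: Dhom_ext => i; rewrite !ord1.
Qed.

Lemma sprod_qcat (X Y : sSet) : is_qcat X -> is_qcat Y -> is_qcat (X *s Y).
Proof.
move=> HX HY n k n2 k0 kn f.
have [g Eg] := HX n k n2 k0 kn (sfst X Y \os f).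
have [h Eh] := HY n k n2 k0 kn (ssnd X Y \os f).
exists (spair g h); apply: sMap_ext => m x /=.
have := congr1 (fun u : sMap _ _ => u m x) Eg.
have := congr1 (fun u : sMap _ _ => u m x) Eh.
by rewrite /= => -> ->; case: (f m x).
Qed.

(** * Operators inside and outside a horn *)

Lemma not_in_hornP n (k : 'I_n.+1) m (f : Dhom m n) (i : 'I_n.+1) :
  ~ in_horn k f -> i <> k -> exists a, f a = i.
Proof.
move=> Hf ik; apply: NNPP => H; apply: Hf; exists i => // a ea.
by apply: H; exists a.
Qed.

Lemma Dface_factor m n (i : 'I_n.+2) (f : Dhom m n.+1) :
  (forall a, f a <> i) -> exists g : Dhom m n, f = Dcomp (Dface i) g.
Proof.
move=> Hf.
have Hg a : exists b, f a = lift i b.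
  by case: (unliftP i (f a)) => [b ->|/Hf//]; exists b.
pose g a := sval (constructive_indefinite_description _ (Hg a)).
have gE a : f a = lift i (g a) by rewrite /g; case: constructive_indefinite_description.
have gm (a b : 'I_m.+1) : a <= b -> g a <= g b.
  by move=> /(Dmono f); rewrite !gE /= leq_bump2.
by exists (MkDhom gm); apply: Dhom_ext => a; rewrite gE.
Qed.

(** Off the horn, [f] hits every vertex except possibly [c]. Any choice of preimages is monotone
    because [f] is, and one preimage can be prescribed. *)
Lemma Dface_section m n (c : 'I_n.+2) (f : Dhom m n.+1) (a0 : 'I_m.+1) (v0 : 'I_n.+1) :
  ~ in_horn c f -> f a0 = lift c v0 ->
  exists2 d : Dhom n m, Dcomp f d = Dface c & d v0 = a0.
Proof.
move=> Hf fa0.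
have Hd v : exists a, f a = lift c v /\ (v = v0 -> a = a0).
  case: (eqVneq v v0) => [->|/eqP vv0]; first by exists a0.
  have [//|a fa] := not_in_hornP (i := lift c v) Hf; last by exists a.
  by move/eqP; rewrite eq_sym (negPf (neq_lift _ _)).
pose d v := sval (constructive_indefinite_description _ (Hd v)).
have dE v : f (d v) = lift c v /\ (v = v0 -> d v = a0).
  by rewrite /d; case: constructive_indefinite_description.
have dm (u v : 'I_n.+1) : u <= v -> d u <= d v.
  move=> uv; case: (leqP (d u) (d v)) => // dvu.
  have := Dmono f (ltnW dvu); rewrite (dE u).1 (dE v).1 /= leq_bump2 => vu.
  have e : u = v by apply: val_inj; apply/eqP; rewrite eqn_leq uv.
  by rewrite e ltnn in dvu.
exists (MkDhom dm); last by exact: (dE v0).2.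
by apply: Dhom_ext => v; rewrite /= (dE v).1.
Qed.

Lemma horn_section m n (c : 'I_n.+2) (f : Dhom m n.+1) :
  ~ in_horn c f -> exists d : Dhom n m, Dcomp f d = Dface c.
Proof.
move=> Hf; have [|a fa] := not_in_hornP Hf (i := lift c ord0).
  by move/eqP; rewrite eq_sym (negPf (neq_lift _ _)).
by have [d fd _] := Dface_section Hf fa; exists d.
Qed.

(** An injective monotone map is strictly increasing, so induction from the bottom gives [i <= f i]
    and induction from the top gives [f i <= i]. *)
Lemma Dhom_inj_id n (f : Dhom n n) : injective f -> f = Did n.
Proof.
move=> fI.
have up : forall m (i : 'I_n.+1), i = m :> nat -> m <= f i.
  elim=> // m IHm i im.
  have mn : m < n.+1 by have := ltn_ord i; lia.
  have ji : Ordinal mn <= i by rewrite /= im.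
  have := Dmono f ji; rewrite leq_eqVlt => /orP[/eqP e|].
    have := congr1 (@nat_of_ord _) (fI _ _ (val_inj e)); rewrite /= im; lia.
  by apply: leq_ltn_trans; exact: IHm.
have down : forall m (i : 'I_n.+1), i + m = n -> f i + m <= n.
  elim=> [|m IHm] i im; first by have := ltn_ord (f i); lia.
  have mn : i.+1 < n.+1 by lia.
  have ij : i <= Ordinal mn by rewrite /=.
  have := IHm (Ordinal mn); rewrite /= addSnnS => /(_ im).
  have := Dmono f ij; rewrite leq_eqVlt => /orP[/eqP e|]; last lia.
  have := congr1 (@nat_of_ord _) (fI _ _ (val_inj e)); rewrite /=; lia.
apply: Dhom_ext => i /=; have := up _ i erefl.
have := down (n - i) i; have := ltn_ord i; lia.
Qed.

(** The section from [horn_section] is injective, since the coface is, hence it is the identity. *)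
Lemma not_in_horn_face n (c : 'I_n.+2) (f : Dhom n n.+1) :
  ~ in_horn c f -> f = Dface c.
Proof.
move=> Hf.
have [d fd] := horn_section Hf.
suff dI : d = Did n by rewrite -fd dI.
apply: Dhom_inj_id => u v e; apply: (@lift_inj _ c).
have := congr1 (fun h : Dhom _ _ => (h u, h v)) fd.
by rewrite /= e => -[<- <-].
Qed.

(** * Partial maps and attaching a simplex along a horn *)

(* A partial map is encoded by its graph [R]; its domain is then automatically a
   simplicial subset of [Y]. *)
Definition is_pmap (Y Z : sSet) (R : forall n, Y n -> Z n -> Prop) : Prop :=
  (forall m n (f : Dhom m n) y z, R n y z -> R m (sact f y) (sact f z)) /\
  (forall n y z z', R n y z -> R n y z' -> z = z').

Definition pdom (Y Z : sSet) (R : forall n, Y n -> Z n -> Prop) n (y : Y n) :=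
  exists z, R n y z.

(* If all faces of [y] except the [c]-th lie in the domain of [R], and the
   [c]-th does not, then adjoining [y] to this domain is a pushout of the horn
   inclusion, whether or not [y] is nondegenerate. *)
Lemma horn_attach (Y Z : sSet) (R : forall n, Y n -> Z n -> Prop) n (c : 'I_n.+2)
    (y : Y n.+1) :
  is_qcat Z -> is_pmap R -> 0 < c -> c < n.+1 ->
  (forall m (f : Dhom m n.+1), in_horn c f -> pdom R (sact f y)) ->
  ~ pdom R (sact (Dface c) y) ->
  exists w : sMap (Delta n.+1) Z,
    is_pmap (fun m y' z => R m y' z \/
      exists f : Dhom m n.+1, y' = sact f y /\ z = w m f).
Proof.
move=> HZ [Rs Rf] c0 cn Hin Hout.
pose h m (f : horn c m) : Z m :=
  sval (constructive_indefinite_description _ (Hin m (sval f) (svalP f))).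
have hE m (f : horn c m) : R m (sact (sval f) y) (h m f).
  by rewrite /h; case: constructive_indefinite_description.
(* The chosen values commute with operators because the graph is single-valued. *)
have hN m m' (g : Dhom m m') (f : horn c m') : h m (sact g f) = sact g (h m' f).
  apply: Rf (hE m (sact g f)) _.
  by rewrite /= sactM; exact: Rs.
have [|w Ew] := HZ n.+1 c _ c0 cn (MkSMap hN); first lia.
have wE m (f : Dhom m n.+1) (Hf : in_horn c f) : R m (sact f y) (w m f).
  have := congr1 (fun u : sMap (horn c) Z => u m (exist _ f Hf)) Ew; rewrite /= => ->.
  exact: (hE m (exist _ f Hf)).
exists w; split.
- move=> m k f y' z [Ryz|[g [-> ->]]]; first by left; exact: Rs.
  by right; exists (Dcomp g f); rewrite -smapN sactM.
(* Off the horn no simplex lies in the old domain: a section over the [c]-th coface would carry it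
   to the [c]-th face of [y]. *)
have notin m (f : Dhom m n.+1) : pdom R (sact f y) -> in_horn c f.
  move=> [z Hz]; apply: NNPP => Hf; apply: Hout.
  have [d fd] := horn_section Hf.
  by exists (sact d z); rewrite -fd sactM; exact: Rs.
have one m y' z (f : Dhom m n.+1) : R m y' z -> y' = sact f y -> z = w m f.
  move=> Rz e; subst y'; apply: (Rf m (sact f y)) => //.
  by apply: wE; apply: notin; exists z.
(* A section [d] of [f] over the coface, chosen through [a], is also one of [g]: otherwise
   [Dcomp g d] would lie in the horn and put the [c]-th face of [y] into the domain. *)
have uniq m (f g : Dhom m n.+1) a : ~ in_horn c f -> ~ in_horn c g ->
    sact f y = sact g y -> f a <> c -> f a = g a.
  move=> Hf Hg e.
  case: (unliftP c (f a)) => [v fa _|//].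
  have [d fd <-] := Dface_section Hf fa.
  have gd : Dcomp g d = Dface c.
    apply: not_in_horn_face => /Hin [z Hz]; apply: Hout; exists z.
    by rewrite -fd sactM e -sactM.
  have := congr1 (fun h : Dhom _ _ => h v) gd.
  by have := congr1 (fun h : Dhom _ _ => h v) fd; rewrite /= => -> ->.
move=> m y' z z' [Rz|[f [ef ->]]] [Rz'|[g [eg ->]]].
- exact: Rf Rz Rz'.
- exact: one Rz eg.
- by symmetry; exact: one Rz' ef.
subst y'; case: (classic (in_horn c f)) => Hf.
  exact: one (wE _ _ Hf) eg.
case: (classic (in_horn c g)) => Hg.
  by symmetry; apply: one (wE _ _ Hg) _; rewrite -eg.
congr (w m _); apply: Dhom_ext => a.
case: (eqVneq (f a) c) => [fc|/eqP fc]; last by rewrite (uniq m f g).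
case: (eqVneq (g a) c) => [->|/eqP gc]; first by rewrite fc.
by rewrite (uniq m g f).
Qed.

(** * Raising the last vertex below [k] *)

Lemma miss_factor m n (i : 'I_n.+1) (f : Dhom m n) :
  (forall a, f a <> i) -> exists p (d : Dhom p n) (g : Dhom m p),
    [/\ p < n, f = Dcomp d g & forall a b : 'I_p.+1, a < b -> d a < d b].
Proof.
case: n i f => [|n] i f Hf; first by case: (Hf ord0); rewrite !ord1.
have [g fg] := Dface_factor Hf; exists n, (Dface i), g; split=> // a b.
by rewrite !ltnNge /= leq_bump2.
Qed.

Definition last_below n (k : 'I_n.+1) m (g : Dhom m n) (v : 'I_m.+1) : Prop :=
  g v < k /\ forall v' : 'I_m.+1, v < v' -> k <= g v'.

(* [g'] arises from [g \o s] by raising to [k] some of the entries lying over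
   the last vertex that [g] sends below [k]. *)
Definition raises n (k : 'I_n.+1) m p (g : Dhom m n) (s : Dhom p m) (g' : Dhom p n) :
    Prop :=
  forall a, g' a = g (s a) \/ g' a = k /\ last_below k g (s a).

(** An arbitrary [s] covers at once the simplex obtained from [(x, g)] by the operation and all its
    images under simplicial operators. *)
Definition raise_closed (X Z : sSet) n (k : 'I_n.+1)
    (R : forall m, (X *s Delta n) m -> Z m -> Prop) : Prop :=
  forall m p (x : X m) (g : Dhom m n) (s : Dhom p m) (g' : Dhom p n),
    raises k g s g' -> pdom R ((x, g) : (X *s Delta n) m) ->
    pdom R ((sact s x, g') : (X *s Delta n) p).

Lemma in_horn_raises n (k : 'I_n.+1) m p (g : Dhom m n) (s : Dhom p m) (g' : Dhom p n) :
  raises k g s g' -> in_horn k g -> in_horn k g'.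
Proof.
move=> gg' [i ik Hi]; exists i => // a.
by case: (gg' a) => [->|[-> _]]; [exact: Hi | exact: nesym].
Qed.

Lemma last_below_max n (k : 'I_n.+1) m (g : Dhom m n) (u v : 'I_m.+1) :
  last_below k g v -> g u < k -> u <= v.
Proof. by move=> [_ H] gu; case: (leqP u v) => // /H; lia. Qed.

Lemma last_below_exists n (k : 'I_n.+1) m (g : Dhom m n) :
  0 < k -> ~ in_horn k g -> exists v, last_below k g v.
Proof.
move=> k0 Hg; have [e|a ga] := not_in_hornP Hg (i := ord0); first by rewrite -e in k0.
have Pa : [pred v | g v < k] a by rewrite /= ga.
case: (arg_maxnP (@nat_of_ord _) Pa) => v gv Hv; exists v; split=> // u vu.
by case: (leqP k (g u)) => // /Hv; lia.
Qed.

(** Vertices up to [v] go below [k] and later ones to at least [k], so sending [v] to [k] preserves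
    order. This gives the [v]-th face of the new simplex. *)
Lemma raise_last_mono n (k : 'I_n.+1) m (g : Dhom m n) (v : 'I_m.+1) :
  last_below k g v -> forall a b : 'I_m.+1, a <= b ->
  (if a == v then k else g a) <= (if b == v then k else g b).
Proof.
move=> [gv Hv] a b ab; case: (eqVneq a v) => av; case: (eqVneq b v) => bv //.
- by apply: Hv; move: ab; rewrite av leq_eqVlt => /orP[/eqP/val_inj e|//]; rewrite e eqxx in bv.
- by apply: leq_trans (ltnW gv); apply: Dmono; rewrite -bv.
- exact: Dmono.
Qed.

(** This gives the new simplex itself; [lift ord0 v] is v + 1, the new copy of [v]. *)
Lemma raise_insert_mono n (k : 'I_n.+1) m (g : Dhom m n) (v : 'I_m.+1) :
  last_below k g v -> forall a b : 'I_m.+2, a <= b ->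
  (if a == lift ord0 v then k else g (Ddegen v a)) <=
  (if b == lift ord0 v then k else g (Ddegen v b)).
Proof.
move=> [gv Hv] a b ab.
have E (c : 'I_m.+2) : (c == lift ord0 v) = (c == v.+1 :> nat) by [].
rewrite !E; case: (eqVneq (a : nat) v.+1) => av; case: (eqVneq (b : nat) v.+1) => bv //.
- by apply: Hv; rewrite /= /unbump; lia.
- by apply: leq_trans (ltnW gv); apply: Dmono; rewrite /= /unbump; lia.
- exact: (Dmono g (Dmono (Ddegen v) ab)).
Qed.

Lemma raise_attach (X Z : sSet) n (k : 'I_n.+1)
    (R : forall m, (X *s Delta n) m -> Z m -> Prop) m (x : X m) (g : Dhom m n) :
  is_qcat Z -> is_pmap R -> raise_closed k R -> 0 < k -> k < n ->
  (forall p (g' : Dhom p n) (x' : X p), in_horn k g' -> pdom R ((x', g') : (X *s Delta n) p)) ->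
  (forall p (x' : X p) (g' : Dhom p n), p < m -> pdom R ((x', g') : (X *s Delta n) p)) ->
  (forall g' : Dhom m n, #|[pred a | g' a < k]| < #|[pred a | g a < k]| ->
     pdom R ((x, g') : (X *s Delta n) m)) ->
  ~ pdom R ((x, g) : (X *s Delta n) m) ->
  exists (y : (X *s Delta n) m.+1) (w : sMap (Delta m.+1) Z),
    let R' p y' z := R p y' z \/ exists f : Dhom p m.+1, y' = sact f y /\ z = w p f in
    [/\ is_pmap R', raise_closed k R' & pdom R' ((x, g) : (X *s Delta n) m)].
Proof.
move=> HZ HR HU k0 kn Hhorn Hdim Hcount Hxg.
have Hg : ~ in_horn k g by move=> /Hhorn H; exact: Hxg.
have [v Hv] := last_below_exists k0 Hg.
(* [g] attains the top vertex, which exceeds [k], so some vertex follows [v] and the position v + 1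
   is inner. *)
have vm : v < m.
  have [e|b gb] := not_in_hornP Hg (i := ord_max); first by move: kn; rewrite -e /= ltnn.
  have vb : v < b by rewrite ltnNge; apply/negP => /(Dmono g); rewrite gb /=; case: Hv => /=; lia.
  by apply: leq_trans vb _; rewrite -ltnS.
pose c : 'I_m.+2 := lift ord0 v.
have cE (a : 'I_m.+2) : (a == c) = (a == v.+1 :> nat) by [].
pose g1 : Dhom m n := MkDhom (raise_last_mono Hv).
pose g2 : Dhom m.+1 n := MkDhom (raise_insert_mono Hv).
have degc : Ddegen v c = v by apply: val_inj; rewrite /= /unbump /bump; lia.
have g1v : g1 v = k by rewrite /= eqxx.
have g1nv a : a <> v -> g1 a = g a by move=> /eqP /negPf e; rewrite /= e.
have g2c : g2 c = k by rewrite /= eqxx.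
have g2nc (a : 'I_m.+2) : a <> c -> g2 a = g (Ddegen v a) by move=> /eqP /negPf e; rewrite /= e.
pose y : (X *s Delta n) m.+1 := (sact (Ddegen v) x, g2).
have yface : sact (Dface c) y = (x, g).
  rewrite /y /=; congr pair.
    rewrite -sactM -[RHS]sact1; congr (sact _ _); apply: Dhom_ext => a.
    by rewrite /= /unbump /bump /=; lia.
  apply: Dhom_ext => a; rewrite /= -[lift _ _]/(lift c a) eq_sym (negPf (neq_lift _ _)).
  by congr (nat_of_ord (g _)); apply: val_inj; rewrite /= /unbump /bump /=; lia.
have Hin p (f : Dhom p m.+1) : in_horn c f -> pdom R (sact f y).
  move=> [i ic Hi]; case: (eqVneq (i : nat) v) => iv.
    (* Operators missing [v] factor through the [v]-th face [(x, g1)], which has fewer vertices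
       below [k]. *)
    have [z Hz] : pdom R ((x, g1) : (X *s Delta n) m).
      apply: Hcount; apply: proper_card; apply/properP; split.
        by apply/subsetP => a; rewrite !inE /=; case: eqP => // _; rewrite ltnn.
      by exists v; rewrite !inE /= ?eqxx ?ltnn ?(proj1 Hv).
    exists (sact (Dcomp (Ddegen v) f) z).
    have -> : sact f y = sact (Dcomp (Ddegen v) f) ((x, g1) : (X *s Delta n) m).
      rewrite /y /=; congr pair; first by rewrite sactM.
      apply: Dhom_ext => a; congr nat_of_ord; change (g2 (f a) = g1 (Ddegen v (f a))).
      case: (eqVneq (f a) c) => [->|/eqP fc]; first by rewrite g2c degc g1v.
      rewrite g2nc // g1nv // => /(congr1 (@nat_of_ord _)) e; case: (Hi a); apply: val_inj.
      by move/eqP: fc; move: e; rewrite cE /= /unbump; lia.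
    by case: HR => Rs _; exact: Rs.
  (* Operators missing another vertex factor, after the degeneracy, through a face [d] of smaller
     dimension. The simplex is a raising of that face of [(x, g)]; strictness of [d] keeps the last
     vertex below [k] last. *)
  have [a ea|m' [d [h [m'm eh dlt]]]] := @miss_factor p m (Ddegen v i) (Dcomp (Ddegen v) f).
    case: (Hi a); apply: val_inj.
    move/(congr1 (@nat_of_ord _)): ea; move: ic => /eqP; rewrite cE /= /unbump; lia.
  have ehE a : Ddegen v (f a) = d (h a).
    by have := congr1 (fun h : Dhom _ _ => h a) eh.
  have [] := HU m' p (sact d x) (Dcomp g d) h (Dcomp g2 f); last 2 first.
  - exact: Hdim.
  - by move=> z Hz; exists z; rewrite /y /= -sactM eh sactM.
  move=> a; case: (eqVneq (f a) c) => [fc|/eqP fc]; [right|left].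
    split; first by rewrite -g2c -fc.
    have hv : d (h a) = v by rewrite -ehE fc.
    split; first by rewrite /= hv (proj1 Hv).
    by move=> u hu; apply: (proj2 Hv); rewrite -hv; exact: dlt.
  by rewrite [LHS]g2nc // ehE.
have [|||w Hw] := horn_attach HZ HR _ _ Hin.
- by [].
- by rewrite /c /= /bump /=; lia.
- by rewrite yface.
exists y, w => R'; split=> //; last first.
  by exists (w m (Dface c)); right; exists (Dface c); rewrite yface.
(* Only the simplices [sact f y] with [f] off the horn are new. Such an [f] hits [v], so the last
   vertex below [k] lies over [v]. *)
move=> p q x' g' s g'' Hr [z [Hz|[f [ef _]]]].
  by have [|z' Hz'] := HU _ _ x' _ _ _ Hr; [exists z | exists z'; left].
case: (classic (in_horn c f)) => [/Hin|] Hf.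
  by have [|z' Hz'] := HU _ _ x' _ _ _ Hr; [rewrite ef | exists z'; left].
have /= ex := congr1 fst ef; have /= eg := congr1 snd ef; move: ef => _.
subst x' g'.
have [b fb] : exists b, f b = widen_ord (leqnSn _) v.
  by apply: (not_in_hornP Hf) => /(congr1 (@nat_of_ord _)); rewrite /= /bump; lia.
have degw : Ddegen v (widen_ord (leqnSn _) v) = v.
  by apply: val_inj; rewrite /= /unbump; lia.
have g2b : g2 (f b) < k.
  rewrite g2nc fb ?degw ?(proj1 Hv) // => /(congr1 (@nat_of_ord _)).
  by rewrite /= /bump; lia.
have last_f a : last_below k (Dcomp g2 f) a -> f a = v :> nat.
  move=> Ha; have ba : b <= a by exact: last_below_max Ha g2b.
  have := Dmono f ba; rewrite fb /= => vfa; apply/eqP; rewrite eqn_leq vfa andbT.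
  case: Ha => + _; change (g2 (f a) < k -> f a <= v); case: (eqVneq (f a) c) => [->|/eqP fc].
    by rewrite g2c ltnn.
  rewrite g2nc // => /(last_below_max Hv); move/eqP: fc; rewrite cE /= /unbump; lia.
(* [up] marks the entries actually raised; moving them from [v] to [c] exhibits the raised simplex
   as a simplex of [y]. *)
pose up a := (g'' a == k) && (f (s a) == v :> nat).
have upn a : ~~ up a -> g'' a = g2 (f (s a)).
  by case: (Hr a) => [//|[gk /last_f fs]]; rewrite /up gk fs !eqxx.
have upm (a a' : 'I_q.+1) : a <= a' ->
    (if up a then c else f (s a)) <= (if up a' then c else f (s a')).
  move=> aa'; have fsm := Dmono f (Dmono s aa'); have gm := Dmono g'' aa'.
  case: ifPn => ua; case: ifPn => ua' //; last first.
    by case/andP: ua' fsm => _ /eqP e; rewrite /= /bump; lia.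
  case/andP: ua => /eqP gk /eqP e; rewrite /= /bump.
  rewrite gk (upn _ ua') in gm.
  case: (eqVneq (f (s a')) c) => [->|/eqP fc]; first by rewrite /= /bump; lia.
  rewrite g2nc // in gm; rewrite add1n -e ltn_neqAle fsm andbT; apply/eqP => e'.
  have fv : Ddegen v (f (s a')) = v by apply: val_inj; rewrite /= /unbump -e' e; lia.
  by rewrite fv leqNgt (proj1 Hv) in gm.
exists (w q (MkDhom upm)); right; exists (MkDhom upm); split=> //.
rewrite /y /=; congr pair; rewrite -?sactM.
  congr (sact _ _); apply: Dhom_ext => a /=; case: ifP => // /andP[_ /eqP e].
  by rewrite e /= /unbump /bump /=; lia.
apply: Dhom_ext => a; congr nat_of_ord.
change (g'' a = g2 (if up a then c else f (s a))).
by case: ifPn => [/andP[/eqP -> _]|/upn]; rewrite ?g2c.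
Qed.

(** * Extension by Zorn's lemma, and internal homs *)

Lemma horn_prod_extend (X Z : sSet) n (k : 'I_n.+1) (u : sMap (X *s horn k) Z) :
  is_qcat Z -> 0 < k -> k < n ->
  exists w : sMap (X *s Delta n) Z,
    forall m (x : X m) (g : horn k m), w m (x, sval g) = u m (x, g).
Proof.
move=> HZ k0 kn.
pose T := {m : nat & ((X *s Delta n) m * Z m)%type}.
pose pt m y z : T := existT _ m (y, z).
pose R0 m (y : (X *s Delta n) m) (z : Z m) :=
  exists H : in_horn k y.2, z = u m (y.1, exist _ y.2 H).
(* Zorn's lemma is applied to sets [A] of pairs added to the prescribed graph [R0], so the empty
   chain is no exception. *)
pose rel (A : classical_sets.set T) m y z := A (pt m y z) \/ R0 m y z.
pose good (A : classical_sets.set T) := is_pmap (rel A) /\ raise_closed k (rel A).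
have R0u m (x : X m) (g : horn k m) z : R0 m (x, sval g) z -> z = u m (x, g).
  move=> [H ->] /=; congr (u m (x, _)); case: g H => g Hg H /=; congr exist.
  exact: proof_irrelevance.
have R0P : is_pmap R0.
  split=> [m p f y z [H ->]|m y z z' [H ->] [H' ->]].
    exists (in_horn_comp f H); rewrite -smapN /=; congr (u m (_, _)); congr exist.
    exact: proof_irrelevance.
  by congr (u m (_, exist _ _ _)); exact: proof_irrelevance.
have R0U : raise_closed k R0.
  move=> m p x g s g' Hr [z [H _]]; have H' := in_horn_raises Hr H.
  by exists (u p (sact s x, exist _ g' H')), H'.
have [F FP Ftot|A [[AP AU] Amax]] := @classical_sets.Zorn_bigcup T good.
  pose U := rel (classical_sets.bigcup F id).
  have sub A m y z : F A -> rel A m y z -> U m y z.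
    by move=> FA [Ayz|]; [left; exists A | right].
  have pick m y z : U m y z -> R0 m y z \/ exists2 A, F A & rel A m y z.
    by move=> [[A FA Ayz]|]; [right; exists A => //; left | left].
  split; first split.
  - move=> m p f y z /pick[/R0P.1 H|[A FA /(FP A FA).1.1 H]]; first by right; exact: H.
    exact: sub FA (H _ _).
  - move=> m y z z' /pick[H|[A FA HA]] /pick[H'|[A' FA' HA']].
    + exact: R0P.2 H H'.
    + by apply: (FP A' FA').1.2 HA'; right.
    + by apply: (FP A FA).1.2 HA _; right.
    + case: (Ftot _ _ FA FA') => AA'.
      * by apply: (FP A' FA').1.2 HA'; case: HA => [/AA'|]; [left | right].
      * by apply: (FP A FA).1.2 HA _; case: HA' => [/AA'|]; [left | right].
  - move=> m p x g s g' Hr [z /pick[Hz|[A FA Hz]]].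
      by have [|z' Hz'] := R0U _ _ x _ _ _ Hr; [exists z | exists z'; right].
    have [|z' Hz'] := (FP A FA).2 _ _ x _ _ _ Hr; first by exists z.
    by exists z'; exact: sub FA Hz'.
have Hhorn p (g : Dhom p n) (x : X p) : in_horn k g -> pdom (rel A) ((x, g) : (X *s Delta n) p).
  by move=> H; exists (u p (x, exist _ g H)); right; exists H.
have tot : forall m (x : X m) (g : Dhom m n), pdom (rel A) ((x, g) : (X *s Delta n) m).
  (* Induction on the dimension, then on the number of vertices below [k], replaces the choice of a
     minimal missing simplex. *)
  elim/ltn_ind => m IHm x g.
  have [N] := ubnP #|[pred a | g a < k]|; elim: N g => // N IHN g gN.
  apply: NNPP => Hxg.
  have [||y [w [WP WU Wxg]]] := raise_attach HZ AP AU k0 kn Hhorn _ _ Hxg.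
  - by move=> p x' g' pm; exact: IHm.
  - by move=> g' Hg'; apply: IHN; exact: leq_trans Hg' gN.
  pose B : classical_sets.set T := fun t => A t \/
    exists f : Dhom (projT1 t) m.+1,
      (projT2 t).1 = sact f y /\ (projT2 t).2 = w (projT1 t) f.
  have BE : rel B = (fun p y' z => rel A p y' z \/
      exists f : Dhom p m.+1, y' = sact f y /\ z = w p f).
    apply: functional_extensionality_dep => p.
    apply: functional_extensionality => y'; apply: functional_extensionality => z.
    apply: propositional_extensionality; rewrite /rel /B /=; tauto.
  apply: (Amax B); last by rewrite /good BE.
  split; first by move=> t At; left.
  move=> BA; apply: Hxg; move: Wxg; rewrite -BE => -[z [/BA H|H]]; exists z;
    [by left | by right].
pose w m (y : (X *s Delta n) m) : Z m :=
  sval (constructive_indefinite_description _ (tot m y.1 y.2)).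
have wE m (y : (X *s Delta n) m) : rel A m y (w m y).
  by rewrite /w; case: constructive_indefinite_description; case: y.
have wN m p (f : Dhom m p) y : w m (sact f y) = sact f (w p y).
  by apply: AP.2 (wE _ _) _; apply: AP.1.
exists (MkSMap wN) => m x g; apply: AP.2 (wE _ _) _.
by right; case: g => g Hg; exists Hg.
Qed.

Lemma sexp_qcat (X Z : sSet) : is_qcat Z -> is_qcat (sexp X Z).
Proof.
move=> HZ n k _ k0 kn f.
(* Evaluating at the identity operator transposes [f] to a map on [X *s horn k]; [vN] serves to
   transpose its extension back. *)
have uN m p (h : Dhom m p) (y : (X *s horn k) p) :
    (f m (sact h y).2 : sMap _ _) m ((sact h y).1, Did m) =
    sact h ((f p y.2 : sMap _ _) p (y.1, Did p)).
  by rewrite -smapN /= smapN.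
have [w Hw] := horn_prod_extend (MkSMap uN) HZ k0 kn.
have vN m (s : Delta n m) p q (h : Dhom p q) (y : (X *s Delta m) q) :
  w p ((sact h y).1, Dcomp s (sact h y).2) = sact h (w q (y.1, Dcomp s y.2)).
  by rewrite -smapN.
have gN m p (h : Dhom m p) (s : Delta n p) :
    MkSMap (vN m (sact h s)) = sact h (MkSMap (vN p s) : sexp X Z p).
  exact: sMap_ext.
exists (@MkSMap (Delta n) (sexp X Z) (fun m s => MkSMap (vN m s)) gN).
apply: sMap_ext => m s; apply: sMap_ext => p [x h].
have := Hw p x (sact h s) => /= ->.
by rewrite smapN.
Qed.

(** * 2-functoriality and 2-naturality *)

Definition split_epi (C D : Category) (F : Functor C D) : Prop :=
  exists G : Functor D C, F \oc G = fid.

Lemma split_epi_ext (C D E : Category) (P : Functor C D) (F G : Functor D E) :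
  split_epi P -> F \oc P = G \oc P -> F = G.
Proof.
by move=> [Q PQ] e; rewrite -(fcomp1r F) -(fcomp1r G) -PQ !fcompA e.
Qed.

Lemma split_epi_h_pair (X Y : sSet) (C D : Category)
    (P : Functor (hcat X) C) (Q : Functor (hcat Y) D) :
  split_epi P -> split_epi Q ->
  split_epi <| P \oc h_map (sfst X Y), Q \oc h_map (ssnd X Y) |>.
Proof.
move=> [P' PP'] [Q' QQ']; exists (h_prod_inv X Y \oc fcross P' Q').
rewrite fpair_comp -!fcompA.
rewrite (fcompA (h_map (sfst X Y))) (fcompA (h_map (ssnd X Y))).
rewrite h_fst_prod_inv h_snd_prod_inv fst_fpair snd_fpair.
by rewrite !fcompA PP' QQ' !fcomp1l; apply: fpair_ext; rewrite ?fst_fpair ?snd_fpair fcomp1r.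
Qed.

Lemma split_epi_id (C : Category) : split_epi (@fid C).
Proof. by exists fid; rewrite fcomp1l. Qed.

(** The bracketing is that of the composition laws for [prd_act] and [exp_act]; the next lemma has
    that of the naturality laws. *)
Lemma h_prod22_ext (X Y Z W : sSet) (C : Category)
    (F G : Functor ((hcat X *c hcat Y) *c (hcat Z *c hcat W)) C) :
  let p1 := h_map (sfst X Y \os sfst (X *s Y) (Z *s W)) in
  let p2 := h_map (ssnd X Y \os sfst (X *s Y) (Z *s W)) in
  let p3 := h_map (sfst Z W \os ssnd (X *s Y) (Z *s W)) in
  let p4 := h_map (ssnd Z W \os ssnd (X *s Y) (Z *s W)) in
  F \oc <| <| p1, p2 |>, <| p3, p4 |> |> = G \oc <| <| p1, p2 |>, <| p3, p4 |> |> ->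
  F = G.
Proof.
move=> /=; apply: split_epi_ext.
have H := split_epi_h_pair (split_epi_h_pair (split_epi_id (hcat X)) (split_epi_id (hcat Y)))
  (split_epi_h_pair (split_epi_id (hcat Z)) (split_epi_id (hcat W))).
by move: H; rewrite !fcomp1l !fpair_comp -!h_map_comp.
Qed.

Lemma h_prod121_ext (X Y Z W : sSet) (C : Category)
    (F G : Functor ((hcat X *c (hcat Y *c hcat Z)) *c hcat W) C) :
  let p1 := h_map (sfst X (Y *s Z) \os sfst (X *s (Y *s Z)) W) in
  let p2 := h_map (sfst Y Z \os ssnd X (Y *s Z) \os sfst (X *s (Y *s Z)) W) in
  let p3 := h_map (ssnd Y Z \os ssnd X (Y *s Z) \os sfst (X *s (Y *s Z)) W) in
  let p4 := h_map (ssnd (X *s (Y *s Z)) W) in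
  F \oc <| <| p1, <| p2, p3 |> |>, p4 |> = G \oc <| <| p1, <| p2, p3 |> |>, p4 |> ->
  F = G.
Proof.
move=> /=; apply: split_epi_ext.
have H := split_epi_h_pair (split_epi_h_pair (split_epi_id (hcat X))
  (split_epi_h_pair (split_epi_id (hcat Y)) (split_epi_id (hcat Z)))) (split_epi_id (hcat W)).
by move: H; rewrite !fcomp1l !fpair_comp -!h_map_comp.
Qed.

(** This is [t_hom_act] of [qCat2], stated for all simplicial sets. *)
Definition hom'_act (A A' X X' : sSet) :
    Functor (hom' A' A *c hom' X X' *c hom' A X) (hom' A' X') :=
  hom'_comp A' A X' \oc
    <| hom'_comp A X X' \oc <| fsnd \oc ffst, fsnd |>, ffst \oc ffst |>.

(** Turns each component of a composite into [h_map] of a single simplicial map. *)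
Ltac h_collapse :=
  rewrite /hom'_pair /hom'_uncurry /hom'_act /hom'_comp /prd_act /exp_act;
  rewrite /h_map2 /fcross /fmiddle /fswap;
  repeat first
    [ rewrite h_map_prod_inv_pair | rewrite -h_map_comp | rewrite fst_fpair
    | rewrite snd_fpair | rewrite fcomp1l | rewrite fpair_comp | rewrite -fcompA ].

Lemma prd_act_comp (B B' B'' C C' C'' : sSet) :
  prd_act B B'' C C'' \oc fcross (hom'_comp B B' B'') (hom'_comp C C' C'') =
  hom'_comp (B *s C) (B' *s C') (B'' *s C'') \oc
    fcross (prd_act B' B'' C' C'') (prd_act B B' C C') \oc
    @fmiddle (hom' B' B'') (hom' B B') (hom' C' C'') (hom' C C').
Proof.
apply: h_prod22_ext => /=.
h_collapse; congr h_map.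
by apply: sMap_ext => n [[u u'] [v v']]; apply: sMap_ext => k [[b c] s].
Qed.

Lemma exp_act_comp (B B' B'' C C' C'' : sSet) :
  exp_act B B'' C C'' \oc
    fcross (hom'_comp B'' B' B \oc @fswap (hom' B'' B') (hom' B' B)) (hom'_comp C C' C'') =
  hom'_comp (sexp B C) (sexp B' C') (sexp B'' C'') \oc
    fcross (exp_act B' B'' C' C'') (exp_act B B' C C') \oc
    @fmiddle (hom' B'' B') (hom' B' B) (hom' C' C'') (hom' C C').
Proof.
apply: h_prod22_ext => /=; h_collapse; congr h_map.
by apply: sMap_ext => n [[u u'] [v v']]; apply: sMap_ext => k [w s];
  apply: sMap_ext => l [b t].
Qed.


Lemma hom'_pair_natural (A A' B B' C C' : sSet) :
  hom'_pair A' B' C' \oc hom'_act A A' (B *s C) (B' *s C') \oc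
    fcross (fcross (@fid (hom' A' A)) (prd_act B B' C C')) fid =
  <| hom'_act A A' B B' \oc fcross (fcross fid ffst) (ffst \oc hom'_pair A B C),
     hom'_act A A' C C' \oc fcross (fcross fid fsnd) (fsnd \oc hom'_pair A B C) |>.
Proof.
apply: h_prod121_ext => /=; h_collapse; congr fpair; congr h_map;
  by apply: sMap_ext => n [[u [v v']] w]; apply: sMap_ext => k [a s].
Qed.

Lemma hom'_uncurry_natural (A A' B B' C C' : sSet) :
  hom'_uncurry A' B' C' \oc hom'_act A A' (sexp B C) (sexp B' C') \oc
    fcross (fcross (@fid (hom' A' A)) (exp_act B B' C C')) fid =
  hom'_act (A *s B) (A' *s B') C C' \oc
    fcross <| prd_act A' A B' B \oc fcross fid ffst, fsnd \oc fsnd |>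
           (hom'_uncurry A B C).
Proof.
apply: h_prod121_ext => /=; h_collapse; congr h_map.
by apply: sMap_ext => n [[u [v v']] w]; apply: sMap_ext => k [[a b] s].
Qed.

(** * The isomorphisms of hom-categories *)

Lemma fcat1_uniq (C : Category) (F G : Functor C cat1) : F = G.
Proof.
apply: functor_ext => x y f; case: (fmap F f) (fmap G f) => [] [].
by case: (F x) (F y) (G x) (G y) => [] [] [] [].
Qed.

Lemma is_iso_h_map (X Y : sSet) (f : sMap X Y) (g : sMap Y X) :
  g \os f = sid X -> f \os g = sid Y -> is_iso_functor (h_map f).
Proof. by move=> gf fg; exists (h_map g); rewrite -!h_map_comp gf fg !h_map_id. Qed.

Lemma is_iso_comp (C D E : Category) (G : Functor D E) (F : Functor C D) :
  is_iso_functor G -> is_iso_functor F -> is_iso_functor (G \oc F).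
Proof.
move=> [G' [GG' G'G]] [F' [FF' F'F]]; exists (F' \oc G').
by rewrite -!fcompA (fcompA G' G) GG' (fcompA F F') F'F !fcomp1l.
Qed.

Lemma hom'_terminal_iso (A : sSet) : is_iso_functor (to_cat1 (hom' A (Delta 0))).
Proof.
pose t : sexp A (Delta 0) 0 := ssnd A (Delta 0).
exists (fconst cat1 (t : hom' A (Delta 0))); split; last exact: fcat1_uniq.
transitivity (fconst (hom' A (Delta 0)) (t : hom' A (Delta 0))).
  exact: functor_ext.
(* The constant functor is h of a constant map, and all maps into [Delta 0] agree. *)
rewrite -h_sconst -h_map_id; congr h_map.
apply: sMap_ext => n u; apply: sMap_ext => k [a s].
by apply: Dhom_ext => i; rewrite !ord1.
Qed.

Lemma hom'_pair_iso (A B C : sSet) : is_iso_functor (hom'_pair A B C).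
Proof.
(* The functor is h of a simplicial isomorphism followed by the comparison isomorphism of
   [h_prod_iso]. *)
have -> : hom'_pair A B C =
    <| h_map (sfst (sexp A B) (sexp A C)), h_map (ssnd (sexp A B) (sexp A C)) |> \oc
    h_map (spair (sexp_postcomp A (sfst B C)) (sexp_postcomp A (ssnd B C))).
  by h_collapse; congr fpair; congr h_map; exact: sMap_ext.
apply: is_iso_comp; first exact: h_prod_iso.
have gN m n (f : Dhom m n) (y : (sexp A B *s sexp A C) n) :
  spair (sact f y).1 (sact f y).2 = sact f (spair y.1 y.2 : sexp A (B *s C) n).
  exact: sMap_ext.
pose g := @MkSMap (sexp A B *s sexp A C) (sexp A (B *s C)) (fun n y => spair y.1 y.2) gN.
apply: (@is_iso_h_map _ _ _ g).
  by apply: sMap_ext => n u; apply: sMap_ext => k a /=; case: (u k a).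
by apply: sMap_ext => n [u v]; congr pair; apply: sMap_ext.
Qed.

(** The inverse of [suncurry]; the operator [q.2] also acts on the simplex of [A], since [u] takes
    all its arguments in one dimension. *)
Program Definition scurry (A B C : sSet) :
    sMap (sexp (A *s B) C) (sexp A (sexp B C)) :=
  @MkSMap (sexp (A *s B) C) (sexp A (sexp B C))
    (fun n (u : sMap (A *s B *s Delta n) C) =>
      @MkSMap (A *s Delta n) (sexp B C)
        (fun m (p : (A *s Delta n) m) =>
          @MkSMap (B *s Delta m) C
            (fun k (q : (B *s Delta m) k) => u k (sact q.2 p.1, q.1, Dcomp p.2 q.2)) _) _) _.
Next Obligation. by move=> *; rewrite -smapN /= sactM. Qed.
Next Obligation. by move=> *; apply: sMap_ext => ? []* /=; rewrite sactM. Qed.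
Next Obligation. by move=> *; apply: sMap_ext => ? []*; apply: sMap_ext => ? []*. Qed.

Lemma hom'_uncurry_iso (A B C : sSet) : is_iso_functor (hom'_uncurry A B C).
Proof.
apply: (@is_iso_h_map _ _ _ (scurry A B C)).
  apply: sMap_ext => n u; apply: sMap_ext => k [a s]; apply: sMap_ext => l [b t] /=.
  by have := smapN u t ((a, s) : (A *s Delta n) k); rewrite /= => ->.
apply: sMap_ext => n u; apply: sMap_ext => k [[a b] s] /=.
by rewrite sact1.
Qed.

Theorem proposition3p2p4 :
  exists (one_qcat : is_qcat (Delta 0))
         (prd_qcat : forall B C : QCat, is_qcat (B *s C))
         (exp_qcat : forall B C : QCat, is_qcat (sexp B C)),
    @is_cartesian_closed qCat2
      (MkQCat one_qcat)
      (fun B C : QCat => MkQCat (prd_qcat B C))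
      (fun B C : QCat => MkQCat (exp_qcat B C))
      (fun B B' C C' : QCat => prd_act B B' C C')
      (fun B B' C C' : QCat => exp_act B B' C C')
      (fun A B C : QCat => hom'_pair A B C)
      (fun A B C : QCat => hom'_uncurry A B C).
Proof.
exists delta0_qcat, (fun B C : QCat => sprod_qcat (@qcatP B) (@qcatP C)),
  (fun B C : QCat => @sexp_qcat B C (@qcatP C)); split.
- by move=> B C; apply: sMap_ext => n [[b c] s].
- by move=> B B' B'' C C' C''; exact: prd_act_comp.
- by move=> B C; apply: sMap_ext => n [u s]; apply: sMap_ext => k [b t].
- by move=> B B' B'' C C' C''; exact: exp_act_comp.
- by move=> A; exact: hom'_terminal_iso.
- by move=> A B C; exact: hom'_pair_iso.
- by move=> A B C; exact: hom'_uncurry_iso.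
- by move=> A A'; exact: fcat1_uniq.
- by move=> A A' B B' C C'; exact: hom'_pair_natural.
- by move=> A A' B B' C C'; exact: hom'_uncurry_natural.
Qed.
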